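(* Let $X$ be a non-empty set, let $\mathsf{FFBR}(X)$ be the free $X$-generated $F$-birestriction monoid, and let $$\mathcal I=\mathrm{Inv}\langle X\cup\overline{X^+}\mid \overline{x}\ge x\ (x\in X),\ \ \overline{uv}\ge\overline{u}\,\overline{v}\ (u,v\in X^+)\rangle .$$ The Schützenberger graphs of elements of $\mathcal I$ (with respect to the generators $X\cup\overline{X^+}$) are finite and effectively constructed. Consequently, the word problem for $\mathcal I$ and the word problem for $\mathsf{FFBR}(X)$ are decidable.
   Context: A birestriction monoid is an algebra $(S;\cdot,{}^*,{}^+,1)$ such that $(S;\cdot,1)$ is a monoid and for all $x,y$: $xx^*=x$, $x^*y^*=y^*x^*$, $(xy^* )^*=x^*y^*$, $x^*y=y(xy)^*$; $x^+x=x$, $x^+y^+=y^+x^+$, $(x^+y)^+=x^+y^+$, $xy^+=(xy)^+x$; $(x^+)^*=x^+$, $(x^* )^+=x^*$. Its projections are $P(S)=\{s^*:s\in S\}=\{s^+:s\in S\}$; $s\le t$ iff $s=et$ for some $e\in P(S)$; $s\mathrel{\sigma}t$ iff $se=te$ for some $e\in P(S)$. An $F$-birestriction monoid is a birestriction monoid in which every $\sigma$-class has a maximum element with respect to $\le$; $s^{\mathfrak m}$ denotes the maximum element of the $\sigma$-class of $s$. $F$-birestriction monoids are regarded as algebras $(S;\cdot,{}^*,{}^+,{}^{\mathfrak m},1)$ of type $(2,1,1,1,0)$ (they form a variety), and $\mathsf{FFBR}(X)$ is the free algebra on $X$ in this variety. $X^+$ is the free semigroup on $X$; $\overline{X^+}=\{\overline{u}:u\in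 X^+\}$ is a set disjoint from $X$ in bijection with $X^+$. In an inverse monoid $a^*=a^{-1}a$, $a^+=aa^{-1}$, and a relation $a\ge b$ abbreviates $b=ab^*$. $\mathrm{Inv}\langle Y\mid R\rangle$ denotes an inverse monoid presentation. For an inverse monoid $S$ generated by $Y$ and $s\in S$, the Schützenberger graph of $s$ has as vertices the elements of the $\mathcal R$-class of $s$ (all $t$ with $tt^{-1}=ss^{-1}$), and an edge labeled $y\in Y\cup Y^{-1}$ from $t$ to $t'$ whenever $t,t'$ are vertices and $t'=t[y]_S$, where $[w]_S$ is the value in $S$ of a word $w$ over $Y\cup Y^{-1}$. ''Effectively constructed'' means that there is an algorithm which, given a word $w$ over $Y\cup Y^{-1}$, constructs the Schützenberger graph of $[w]_S$. The word problem for $\mathcal I$ is to decide, given two words over $Y\cup Y^{-1}$ with $Y=X\cup\overline{X^+}$, whether they have the same value in $\mathcal I$; the word problem for $\mathsf{FFBR}(X)$ is to decide, given two terms over $X$ in the signature $(\cdot,{}^*,{}^+,{}^{\mathfrak m},1)$, whether they have the same value in $\mathsf{FFBR}(X)$. Letters of $X$ are treated as formal symbols. *)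

(* Defs.v *)
From HB Require Import structures.
From Stdlib Require List.
From mathcomp Require Import all_boot generic_quotient.
From mathcomp Require Import boolp classical_sets functions cardinality.
Set Implicit Arguments.
Unset Strict Implicit.
Unset Printing Implicit Defensive.
Local Open Scope quotient_scope.
Local Open Scope classical_set_scope.
Local Open Scope group_scope.

HB.mixin Record Monoid_isBirestriction S of Monoid S := {
  star : S -> S;
  plus : S -> S;
  mul_star : forall x : S, x * star x = x;
  starC : forall x y : S, star x * star y = star y * star x;
  star_mulstar : forall x y : S, star (x * star y) = star x * star y;
  starA : forall x y : S, star x * y = y * star (x * y);
  plus_mul : forall x : S, plus x * x = x;
  plusC : forall x y : S, plus x * plus y = plus y * plus x;
  plus_plusmul : forall x y : S, plus (plus x * y) = plus x * plus y;
  plusA : forall x y : S, x * plus y = plus (x * y) * x;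
  star_plus : forall x : S, star (plus x) = plus x;
  plus_star : forall x : S, plus (star x) = star x
}.

#[short(type="birestrictionMonoidType")]
HB.structure Definition BirestrictionMonoid :=
  {S of Monoid_isBirestriction S & Monoid S}.

Definition projection (S : birestrictionMonoidType) (e : S) : Prop :=
  exists s : S, e = star s.

Definition natural_le (S : birestrictionMonoidType) (s t : S) : Prop :=
  exists2 e : S, projection e & s = e * t.

Definition sigma (S : birestrictionMonoidType) (s t : S) : Prop :=
  exists2 e : S, projection e & s * e = t * e.

Definition max_of_sigma_class (S : birestrictionMonoidType) (s m : S) : Prop :=
  sigma s m /\ forall t : S, sigma s t -> natural_le t m.

HB.mixin Record Birestriction_isF S of BirestrictionMonoid S := {
  fmax : S -> S;
  fmaxP : forall s : S, max_of_sigma_class s (fmax s)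
}.

#[short(type="fBirestrictionMonoidType")]
HB.structure Definition FBirestrictionMonoid :=
  {S of Birestriction_isF S & BirestrictionMonoid S}.

Definition fbr_morphism (S T : fBirestrictionMonoidType) (h : S -> T) : Prop :=
  [/\ h 1 = 1,
      forall x y, h (x * y) = h x * h y,
      forall x, h (star x) = star (h x),
      forall x, h (plus x) = plus (h x) &
      forall x, h (fmax x) = fmax (h x)].

Inductive term (X : Type) : Type :=
| TVar of X
| TOne
| TMul of term X & term X
| TStar of term X
| TPlus of term X
| TMax of term X.
Arguments TOne {X}.

Fixpoint term_val (X : Type) (S : fBirestrictionMonoidType) (f : X -> S)
    (t : term X) : S :=
  match t with
  | TVar x => f x
  | TOne => 1
  | TMul a b => term_val f a * term_val f b
  | TStar a => star (term_val f a)
  | TPlus a => plus (term_val f a)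
  | TMax a => fmax (term_val f a)
  end.

(* The free algebra of the variety is the term algebra modulo the identities
   that hold in all members of the variety; [FFBR_free] below is its universal
   property. *)
Definition term_eqv (X : Type) (s t : term X) : Prop :=
  forall (S : fBirestrictionMonoidType) (f : X -> S),
    term_val f s = term_val f t.

Definition term_eqvb (X : Type) : rel {classic term X} :=
  fun s t => `[< term_eqv s t >].

Lemma term_eqvb_refl X : reflexive (@term_eqvb X).
Proof. by move=> t; apply/asboolP. Qed.

Lemma term_eqvb_sym X : symmetric (@term_eqvb X).
Proof. by move=> s t; apply/asboolP/asboolP => h S f; rewrite h. Qed.

Lemma term_eqvb_trans X : transitive (@term_eqvb X).
Proof.
by move=> t s r /asboolP h1 /asboolP h2; apply/asboolP => S f; rewrite h1.
Qed.

Canonical term_equiv (X : Type) :=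
  EquivRel (@term_eqvb X) (@term_eqvb_refl X) (@term_eqvb_sym X)
    (@term_eqvb_trans X).

Definition FFBR (X : Type) : Type := {eq_quot (term_equiv X)}.

HB.instance Definition _ (X : Type) :=
  Choice.copy (FFBR X) {eq_quot (term_equiv X)}.

Definition ffbr_class (X : Type) (t : term X) : FFBR X :=
  \pi_({eq_quot (term_equiv X)}) (t : {classic term X}).

Definition ffbr_repr (X : Type) (a : FFBR X) : term X :=
  repr (a : {eq_quot (term_equiv X)}).

Lemma ffbr_reprK X (a : FFBR X) : ffbr_class (ffbr_repr a) = a.
Proof. exact: (@reprK _ {eq_quot (term_equiv X)}). Qed.

Lemma ffbr_classP X (s t : term X) :
  ffbr_class s = ffbr_class t <-> term_eqv s t.
Proof.
split=> [/eqmodP/asboolP //|h].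
by apply/eqmodP/asboolP.
Qed.

Lemma ffbr_repr_eqv X (t : term X) : term_eqv (ffbr_repr (ffbr_class t)) t.
Proof. by apply/ffbr_classP; rewrite ffbr_reprK. Qed.

Definition ffbr_one (X : Type) : FFBR X := ffbr_class TOne.
Definition ffbr_mul (X : Type) (a b : FFBR X) : FFBR X :=
  ffbr_class (TMul (ffbr_repr a) (ffbr_repr b)).
Definition ffbr_star (X : Type) (a : FFBR X) : FFBR X :=
  ffbr_class (TStar (ffbr_repr a)).
Definition ffbr_plus (X : Type) (a : FFBR X) : FFBR X :=
  ffbr_class (TPlus (ffbr_repr a)).
Definition ffbr_max (X : Type) (a : FFBR X) : FFBR X :=
  ffbr_class (TMax (ffbr_repr a)).

Lemma ffbr_mulE X (s t : term X) :
  ffbr_mul (ffbr_class s) (ffbr_class t) = ffbr_class (TMul s t).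
Proof. by apply/ffbr_classP => S f /=; rewrite !ffbr_repr_eqv. Qed.

Lemma ffbr_starE X (s : term X) :
  ffbr_star (ffbr_class s) = ffbr_class (TStar s).
Proof. by apply/ffbr_classP => S f /=; rewrite !ffbr_repr_eqv. Qed.

Lemma ffbr_plusE X (s : term X) :
  ffbr_plus (ffbr_class s) = ffbr_class (TPlus s).
Proof. by apply/ffbr_classP => S f /=; rewrite !ffbr_repr_eqv. Qed.

Lemma ffbr_maxE X (s : term X) :
  ffbr_max (ffbr_class s) = ffbr_class (TMax s).
Proof. by apply/ffbr_classP => S f /=; rewrite !ffbr_repr_eqv. Qed.

Lemma ffbr_ind X (P : FFBR X -> Prop) :
  (forall t, P (ffbr_class t)) -> forall a, P a.
Proof. by move=> h a; rewrite -(ffbr_reprK a). Qed.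

Lemma ffbr_mulA X : associative (@ffbr_mul X).
Proof.
elim/ffbr_ind=> r; elim/ffbr_ind=> s; elim/ffbr_ind=> t.
by rewrite !ffbr_mulE; apply/ffbr_classP => S f /=; rewrite mulgA.
Qed.

Lemma ffbr_1mul X : left_id (ffbr_one X) (@ffbr_mul X).
Proof.
elim/ffbr_ind=> t.
by rewrite /ffbr_one ffbr_mulE; apply/ffbr_classP => S f /=; rewrite mul1g.
Qed.

Lemma ffbr_mul1 X : right_id (ffbr_one X) (@ffbr_mul X).
Proof.
elim/ffbr_ind=> t.
by rewrite /ffbr_one ffbr_mulE; apply/ffbr_classP => S f /=; rewrite mulg1.
Qed.

HB.instance Definition _ (X : Type) :=
  isMonoid.Build (FFBR X) (@ffbr_mulA X) (@ffbr_1mul X) (@ffbr_mul1 X).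


Lemma ffbr_mulgE X (s t : term X) :
  ffbr_class s * ffbr_class t = ffbr_class (TMul s t).
Proof. exact: ffbr_mulE. Qed.

Lemma ffbr_mul_star X (a : FFBR X) : a * ffbr_star a = a.
Proof.
elim/ffbr_ind: a => s; rewrite !(ffbr_mulgE, ffbr_starE, ffbr_plusE).
by apply/ffbr_classP => S f; apply: mul_star.
Qed.

Lemma ffbr_starC X (a b : FFBR X) :
  ffbr_star a * ffbr_star b = ffbr_star b * ffbr_star a.
Proof.
elim/ffbr_ind: a => s; elim/ffbr_ind: b => t.
rewrite !(ffbr_mulgE, ffbr_starE, ffbr_plusE).
by apply/ffbr_classP => S f; apply: starC.
Qed.

Lemma ffbr_star_mulstar X (a b : FFBR X) :
  ffbr_star (a * ffbr_star b) = ffbr_star a * ffbr_star b.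
Proof.
elim/ffbr_ind: a => s; elim/ffbr_ind: b => t.
rewrite !(ffbr_mulgE, ffbr_starE, ffbr_plusE).
by apply/ffbr_classP => S f; apply: star_mulstar.
Qed.

Lemma ffbr_starA X (a b : FFBR X) :
  ffbr_star a * b = b * ffbr_star (a * b).
Proof.
elim/ffbr_ind: a => s; elim/ffbr_ind: b => t.
rewrite !(ffbr_mulgE, ffbr_starE, ffbr_plusE).
by apply/ffbr_classP => S f; apply: starA.
Qed.

Lemma ffbr_plus_mul X (a : FFBR X) : ffbr_plus a * a = a.
Proof.
elim/ffbr_ind: a => s; rewrite !(ffbr_mulgE, ffbr_starE, ffbr_plusE).
by apply/ffbr_classP => S f; apply: plus_mul.
Qed.

Lemma ffbr_plusC X (a b : FFBR X) :
  ffbr_plus a * ffbr_plus b = ffbr_plus b * ffbr_plus a.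
Proof.
elim/ffbr_ind: a => s; elim/ffbr_ind: b => t.
rewrite !(ffbr_mulgE, ffbr_starE, ffbr_plusE).
by apply/ffbr_classP => S f; apply: plusC.
Qed.

Lemma ffbr_plus_plusmul X (a b : FFBR X) :
  ffbr_plus (ffbr_plus a * b) = ffbr_plus a * ffbr_plus b.
Proof.
elim/ffbr_ind: a => s; elim/ffbr_ind: b => t.
rewrite !(ffbr_mulgE, ffbr_starE, ffbr_plusE).
by apply/ffbr_classP => S f; apply: plus_plusmul.
Qed.

Lemma ffbr_plusA X (a b : FFBR X) :
  a * ffbr_plus b = ffbr_plus (a * b) * a.
Proof.
elim/ffbr_ind: a => s; elim/ffbr_ind: b => t.
rewrite !(ffbr_mulgE, ffbr_starE, ffbr_plusE).
by apply/ffbr_classP => S f; apply: plusA.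
Qed.

Lemma ffbr_star_plus X (a : FFBR X) : ffbr_star (ffbr_plus a) = ffbr_plus a.
Proof.
elim/ffbr_ind: a => s; rewrite !(ffbr_mulgE, ffbr_starE, ffbr_plusE).
by apply/ffbr_classP => S f; apply: star_plus.
Qed.

Lemma ffbr_plus_star X (a : FFBR X) : ffbr_plus (ffbr_star a) = ffbr_star a.
Proof.
elim/ffbr_ind: a => s; rewrite !(ffbr_mulgE, ffbr_starE, ffbr_plusE).
by apply/ffbr_classP => S f; apply: plus_star.
Qed.

HB.instance Definition _ (X : Type) :=
  Monoid_isBirestriction.Build (FFBR X)
    (@ffbr_mul_star X) (@ffbr_starC X) (@ffbr_star_mulstar X) (@ffbr_starA X)
    (@ffbr_plus_mul X) (@ffbr_plusC X) (@ffbr_plus_plusmul X) (@ffbr_plusA X)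
    (@ffbr_star_plus X) (@ffbr_plus_star X).

Lemma natural_le_plus (S : birestrictionMonoidType) (s t : S) :
  natural_le s t -> s = plus s * t.
Proof.
move=> [_ [r ->] {1 2}->].
by rewrite -(plus_star r) plus_plusmul -mulgA plus_mul.
Qed.

Lemma natural_le_star (S : birestrictionMonoidType) (s t : S) :
  natural_le s t -> s = t * star s.
Proof.
move=> [_ [r ->] {1 2}->].
have {1}<- : star (star r) = star r.
  by rewrite -{1}(plus_star r) star_plus plus_star.
exact: starA.
Qed.

Lemma sigma_refl (S : birestrictionMonoidType) (s : S) : sigma s s.
Proof. by exists (star s) => //; exists s. Qed.

Lemma fmax_ge (S : fBirestrictionMonoidType) (s : S) : natural_le s (fmax s).
Proof. by have [_] := fmaxP s; apply; apply: sigma_refl. Qed.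

Lemma ffbr_fmaxP X (a : FFBR X) : max_of_sigma_class a (ffbr_max a).
Proof.
elim/ffbr_ind: a => s; rewrite ffbr_maxE; split.
  exists (star (ffbr_class s)); first by exists (ffbr_class s).
  rewrite mul_star [star _]ffbr_starE [RHS]ffbr_mulgE.
  apply/ffbr_classP => S f /=; exact/natural_le_star/fmax_ge.
elim/ffbr_ind=> t [_ [c ->]]; elim/ffbr_ind: c => r.
rewrite [star _]ffbr_starE [LHS]ffbr_mulgE [RHS]ffbr_mulgE => /ffbr_classP h.
exists (plus (ffbr_class t)).
  by exists (plus (ffbr_class t)); rewrite star_plus.
rewrite [plus _]ffbr_plusE [RHS]ffbr_mulgE; apply/ffbr_classP => S f /=.
apply: natural_le_plus; have [_] := fmaxP (term_val f s); apply.
by exists (star (term_val f r)); [exists (term_val f r) | apply: h].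
Qed.

HB.instance Definition _ (X : Type) :=
  Birestriction_isF.Build (FFBR X) (@ffbr_fmaxP X).

Definition ffbr_gen (X : Type) (x : X) : FFBR X := ffbr_class (TVar x).

Lemma ffbr_term_val X (t : term X) :
  term_val (@ffbr_gen X) t = ffbr_class t.
Proof.
elim: t => //= [a -> b ->|a ->|a ->|a ->].
- exact: ffbr_mulgE.
- exact: ffbr_starE.
- exact: ffbr_plusE.
- exact: ffbr_maxE.
Qed.

Lemma term_val_morphism X (S T : fBirestrictionMonoidType) (h : S -> T)
    (f : X -> S) (t : term X) :
  fbr_morphism h -> h (term_val f t) = term_val (h \o f) t.
Proof.
by move=> [h1 hM hs hp hm]; elim: t => //= [a <- b <-|a <-|a <-|a <-].
Qed.

Theorem FFBR_free (X : Type) (S : fBirestrictionMonoidType) (f : X -> S) :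
  exists! h : FFBR X -> S,
    fbr_morphism h /\ forall x, h (ffbr_gen x) = f x.
Proof.
have hE t : term_val f (ffbr_repr (ffbr_class t)) = term_val f t.
  exact: ffbr_repr_eqv.
exists (fun a => term_val f (ffbr_repr a)); split.
  split; last by move=> x; rewrite hE.
  split; first exact: hE.
  - elim/ffbr_ind=> s; elim/ffbr_ind=> t.
    by rewrite [_ * _]ffbr_mulgE !hE.
  - by elim/ffbr_ind=> s; rewrite [star _]ffbr_starE !hE.
  - by elim/ffbr_ind=> s; rewrite [plus _]ffbr_plusE !hE.
  - by elim/ffbr_ind=> s; rewrite [fmax _]ffbr_maxE !hE.
move=> h [hm hx]; apply/funext; elim/ffbr_ind=> t.
rewrite hE -[in RHS]ffbr_term_val term_val_morphism//.
by congr term_val; apply/funext => x /=; rewrite hx.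
Qed.

(* Inverse monoids are the monoids with involution whose elements are regular
   and in which the idempotents x * x^-1 commute. *)
HB.mixin Record StarMonoid_isInverse S of StarMonoid S := {
  mulgVg : forall x : S, x * x^-1 * x = x;
  mulgVC : forall x y : S,
    (x * x^-1) * (y * y^-1) = (y * y^-1) * (x * x^-1)
}.

#[short(type="inverseMonoidType")]
HB.structure Definition InverseMonoid :=
  {S of StarMonoid_isInverse S & StarMonoid S}.

(* (y, false) stands for y and (y, true) for its formal inverse *)
Definition letter (Y : Type) : Type := (Y * bool)%type.
Definition word (Y : Type) : Type := seq (letter Y).

Definition letter_inv (Y : Type) (l : letter Y) : letter Y := (l.1, ~~ l.2).
Definition word_inv (Y : Type) (w : word Y) : word Y :=
  rev (map (@letter_inv Y) w).

Definition letter_val (Y : Type) (S : inverseMonoidType) (g : Y -> S)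
    (l : letter Y) : S :=
  if l.2 then (g l.1)^-1 else g l.1.

Definition word_val (Y : Type) (S : inverseMonoidType) (g : Y -> S)
    (w : word Y) : S :=
  foldr (fun l s => letter_val g l * s) 1 w.

Section Presentation.
Context (Y : Type) (R : word Y -> word Y -> Prop).

Inductive inv_cong : word Y -> word Y -> Prop :=
| ic_refl u : inv_cong u u
| ic_sym u v : inv_cong u v -> inv_cong v u
| ic_trans u v w : inv_cong u v -> inv_cong v w -> inv_cong u w
| ic_cat u u' v v' :
    inv_cong u u' -> inv_cong v v' -> inv_cong (u ++ v) (u' ++ v')
| ic_inv u v : inv_cong u v -> inv_cong (word_inv u) (word_inv v)
| ic_regular u : inv_cong (u ++ word_inv u ++ u) u
| ic_comm u v :
    inv_cong ((u ++ word_inv u) ++ (v ++ word_inv v))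
             ((v ++ word_inv v) ++ (u ++ word_inv u))
| ic_rel u v : R u v -> inv_cong u v.

Definition inv_congb : rel {classic word Y} := fun u v => `[< inv_cong u v >].

Lemma inv_congb_refl : reflexive inv_congb.
Proof. by move=> u; apply/asboolP/ic_refl. Qed.

Lemma inv_congb_sym : symmetric inv_congb.
Proof. by move=> u v; apply/asboolP/asboolP; apply: ic_sym. Qed.

Lemma inv_congb_trans : transitive inv_congb.
Proof.
by move=> v u w /asboolP h1 /asboolP h2; apply/asboolP/(ic_trans h1 h2).
Qed.

Canonical inv_equiv :=
  EquivRel inv_congb inv_congb_refl inv_congb_sym inv_congb_trans.

Definition Inv : Type := {eq_quot inv_equiv}.

HB.instance Definition _ := Choice.copy Inv {eq_quot inv_equiv}.

Definition inv_class (u : word Y) : Inv :=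
  \pi_({eq_quot inv_equiv}) (u : {classic word Y}).

Definition inv_repr (a : Inv) : word Y := repr (a : {eq_quot inv_equiv}).

Lemma inv_reprK a : inv_class (inv_repr a) = a.
Proof. exact: (@reprK _ {eq_quot inv_equiv}). Qed.

Lemma inv_classP u v : inv_class u = inv_class v <-> inv_cong u v.
Proof. by split=> [/eqmodP/asboolP //|h]; apply/eqmodP/asboolP. Qed.

Lemma inv_repr_cong u : inv_cong (inv_repr (inv_class u)) u.
Proof. by apply/inv_classP; rewrite inv_reprK. Qed.

Lemma inv_class_ind (P : Inv -> Prop) :
  (forall u, P (inv_class u)) -> forall a, P a.
Proof. by move=> h a; rewrite -(inv_reprK a). Qed.

Definition inv_one : Inv := inv_class [::].
Definition inv_mul (a b : Inv) : Inv := inv_class (inv_repr a ++ inv_repr b).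
Definition inv_inv (a : Inv) : Inv := inv_class (word_inv (inv_repr a)).

Lemma inv_mulE u v : inv_mul (inv_class u) (inv_class v) = inv_class (u ++ v).
Proof. by apply/inv_classP; apply: ic_cat; apply: inv_repr_cong. Qed.

Lemma inv_invE u : inv_inv (inv_class u) = inv_class (word_inv u).
Proof. by apply/inv_classP; apply: ic_inv; apply: inv_repr_cong. Qed.

Lemma inv_mulA : associative inv_mul.
Proof.
elim/inv_class_ind=> u; elim/inv_class_ind=> v; elim/inv_class_ind=> w.
by rewrite !inv_mulE catA.
Qed.

Lemma inv_1mul : left_id inv_one inv_mul.
Proof. by elim/inv_class_ind=> u; rewrite inv_mulE. Qed.

Lemma inv_mul1 : right_id inv_one inv_mul.
Proof. by elim/inv_class_ind=> u; rewrite inv_mulE cats0. Qed.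

HB.instance Definition _ := isMonoid.Build Inv inv_mulA inv_1mul inv_mul1.
HB.instance Definition _ := hasInv.Build Inv inv_inv.

Lemma word_invK : involutive (@word_inv Y).
Proof.
move=> u; rewrite /word_inv map_rev revK -map_comp.
by rewrite -[RHS]map_id; apply: eq_map => -[y b] /=; rewrite /letter_inv negbK.
Qed.

Lemma inv_mulgE u v : inv_class u * inv_class v = inv_class (u ++ v).
Proof. exact: inv_mulE. Qed.

Lemma inv_invgE u : (inv_class u)^-1 = inv_class (word_inv u).
Proof. exact: inv_invE. Qed.

Lemma inv_invgK : involutive (@monoid.inv Inv).
Proof.
move=> a; elim/inv_class_ind: a => u.
by rewrite (inv_invgE u) inv_invgE word_invK.
Qed.

Lemma inv_invgM : {morph @monoid.inv Inv : x y / x * y >-> y * x}.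
Proof.
move=> a b; elim/inv_class_ind: a => u; elim/inv_class_ind: b => v.
by rewrite (inv_mulgE u) !inv_invgE inv_mulgE /word_inv map_cat rev_cat.
Qed.

HB.instance Definition _ :=
  Monoid_isStarMonoid.Build Inv inv_invgK inv_invgM.

Lemma inv_mulgVg (x : Inv) : x * x^-1 * x = x.
Proof.
elim/inv_class_ind: x => u; rewrite (inv_invgE u) (inv_mulgE u) inv_mulgE -catA.
exact/inv_classP/ic_regular.
Qed.

Lemma inv_mulgVC (x y : Inv) :
  (x * x^-1) * (y * y^-1) = (y * y^-1) * (x * x^-1).
Proof.
elim/inv_class_ind: x => u; elim/inv_class_ind: y => v.
by rewrite (inv_invgE u) (inv_invgE v) !inv_mulgE; apply/inv_classP/ic_comm.
Qed.

HB.instance Definition _ :=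
  StarMonoid_isInverse.Build Inv inv_mulgVg inv_mulgVC.

Definition inv_gen (y : Y) : Inv := inv_class [:: (y, false)].

Lemma inv_word_val w : word_val inv_gen w = inv_class w.
Proof.
elim: w => //= -[y b] w ->; rewrite /letter_val /=.
by case: b; rewrite ?inv_invgE inv_mulgE.
Qed.

End Presentation.

Lemma word_val_cat Y (S : inverseMonoidType) (f : Y -> S) u v :
  word_val f (u ++ v) = word_val f u * word_val f v.
Proof. by elim: u => [|l u /= ->]; rewrite ?mul1g ?mulgA. Qed.

Lemma word_val_inv Y (S : inverseMonoidType) (f : Y -> S) u :
  word_val f (word_inv u) = (word_val f u)^-1.
Proof.
have inv1 : (1 : S)^-1 = 1.
  by rewrite -[LHS]mulg1 -[X in _ * X]invgK -invgM mulg1 invgK.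
elim: u => [|[y b] u /= IH]; first by rewrite /= inv1.
rewrite /word_inv /= rev_cons -cats1 word_val_cat IH invgM; congr (_ * _).
by rewrite /= mulg1 /letter_val /=; case: b; rewrite ?invgK.
Qed.

Lemma word_val_cong Y (R : word Y -> word Y -> Prop) (S : inverseMonoidType)
    (f : Y -> S) :
  (forall u v, R u v -> word_val f u = word_val f v) ->
  forall u v, inv_cong R u v -> word_val f u = word_val f v.
Proof.
move=> hR u v; elim=> {u v} //.
- by move=> u v w _ -> _ ->.
- by move=> u u' v v' _ hu _ hv; rewrite !word_val_cat hu hv.
- by move=> u v _ hu; rewrite !word_val_inv hu.
- by move=> u; rewrite !word_val_cat word_val_inv mulgA mulgVg.
- by move=> u v; rewrite !word_val_cat !word_val_inv mulgVC.
Qed.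

Theorem Inv_presents (Y : Type) (R : word Y -> word Y -> Prop) :
  (forall u v, R u v ->
     word_val (@inv_gen Y R) u = word_val (@inv_gen Y R) v) /\
  forall (S : inverseMonoidType) (f : Y -> S),
    (forall u v, R u v -> word_val f u = word_val f v) ->
    exists! h : Inv R -> S,
      [/\ h 1 = 1, forall x y, h (x * y) = h x * h y,
          forall x, h x^-1 = (h x)^-1 & forall y, h (inv_gen R y) = f y].
Proof.
split=> [u v h|S f hR]; first by rewrite !inv_word_val; apply/inv_classP/ic_rel.
have hE u : word_val f (inv_repr (inv_class R u)) = word_val f u.
  exact/(word_val_cong hR)/inv_repr_cong.
exists (fun a => word_val f (inv_repr a)); split.
  split=> [|||y]; first exact: hE.
  - elim/inv_class_ind=> u; elim/inv_class_ind=> v.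
    by rewrite inv_mulgE !hE word_val_cat.
  - by elim/inv_class_ind=> u; rewrite inv_invgE !hE word_val_inv.
  - by rewrite hE /= mulg1.
move=> h [h1 hM hV hg]; apply/funext; elim/inv_class_ind=> u.
rewrite hE -inv_word_val; elim: u => [|[y b] u /= ->]; first by rewrite /= h1.
by rewrite hM /letter_val /=; case: b; rewrite ?hV hg.
Qed.

(* [word_ge a b] is the relation a >= b, i.e. b = a b^* with b^* = b^-1 b *)
Definition word_ge (Y : Type) (a b : word Y) : word Y * word Y :=
  (b, a ++ word_inv b ++ b).

(* X^+: a non-empty word is given by its first letter and its tail *)
Definition free_semigroup (X : Type) : Type := (X * seq X)%type.
Definition fs_letter (X : Type) (x : X) : free_semigroup X := (x, [::]).
Definition fs_seq (X : Type) (u : free_semigroup X) : seq X := u.1 :: u.2.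
Definition fs_cat (X : Type) (u v : free_semigroup X) : free_semigroup X :=
  (u.1, u.2 ++ fs_seq v).

Definition gens (X : Type) : Type := (X + free_semigroup X)%type.
Definition plain (X : Type) (x : X) : word (gens X) := [:: (inl x, false)].
Definition over (X : Type) (u : free_semigroup X) : word (gens X) :=
  [:: (inr u, false)].

Inductive rel_I (X : Type) : word (gens X) -> word (gens X) -> Prop :=
| rel_I_letter (x : X) :
    let r := word_ge (over (fs_letter x)) (plain x) in rel_I r.1 r.2
| rel_I_cat (u v : free_semigroup X) :
    let r := word_ge (over (fs_cat u v)) (over u ++ over v) in rel_I r.1 r.2.

Definition monoid_I (X : Type) : inverseMonoidType := Inv (@rel_I X).
Definition gen_I (X : Type) : gens X -> monoid_I X := @inv_gen _ (@rel_I X).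

Definition sch_vertices (S : inverseMonoidType) (s : S) : set S :=
  [set t | t * t^-1 = s * s^-1].

Definition sch_edges (Y : Type) (S : inverseMonoidType) (g : Y -> S) (s : S) :
    set (S * letter Y * S) :=
  [set e | let: (t, l, t') := e in
     [/\ sch_vertices s t, sch_vertices s t' & t' = t * letter_val g l]].

Record finite_graph (L : Type) : Type := FiniteGraph {
  nb_vertices : nat;
  edge_list : seq (nat * L * nat)
}.

(* the labeled graph with vertices V and edges E is isomorphic to G, whose
   vertices are the numbers smaller than [nb_vertices G] *)
Definition graph_iso (L T : Type) (G : finite_graph L)
    (V : set T) (E : set (T * L * T)) : Prop :=
  exists2 f : nat -> T, set_bij [set i | (i < nb_vertices G)%N] V f &
    forall i l j, List.In (i, l, j) (edge_list G) <->
      [/\ (i < nb_vertices G)%N, (j < nb_vertices G)%N & E (f i, l, f j)].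

(* The model of computation is N. D. Jones's WHILE language: the data are
   binary trees and the store is a single tree. It is Turing complete. *)
Inductive data : Type := Nil | Cons of data & data.

Definition hd (d : data) : data := if d is Cons a _ then a else Nil.
Definition tl (d : data) : data := if d is Cons _ b then b else Nil.

Inductive prog : Type :=
| PId
| PNil
| PHd
| PTl
| PCons of prog & prog
| PSeq of prog & prog
| PIf of prog & prog & prog
| PWhile of prog & prog.

(* [run p d d']: on input d the program p terminates with output d';
   in tests, Nil is false and all other trees are true *)
Inductive run : prog -> data -> data -> Prop :=
| run_id d : run PId d d
| run_nil d : run PNil d Nil
| run_hd d : run PHd d (hd d)
| run_tl d : run PTl d (tl d)
| run_cons p q d a b : run p d a -> run q d b -> run (PCons p q) d (Cons a b)
| run_seq p q d d' d'' : run p d d' -> run q d' d'' -> run (PSeq p q) d d''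
| run_if_true c p q d a b d' :
    run c d (Cons a b) -> run p d d' -> run (PIf c p q) d d'
| run_if_false c p q d d' :
    run c d Nil -> run q d d' -> run (PIf c p q) d d'
| run_while_true c p d a b d' d'' :
    run c d (Cons a b) -> run p d d' -> run (PWhile c p) d' d'' ->
    run (PWhile c p) d d''
| run_while_false c p d : run c d Nil -> run (PWhile c p) d d.

Lemma run_det p d d1 d2 : run p d d1 -> run p d d2 -> d1 = d2.
Proof.
move=> h; elim: h d2 => {p d d1} *;
  match goal with h : run _ _ ?d |- _ = ?d => inversion h; subst end;
  repeat match goal with
  | K : (forall e, run ?c ?d e -> _ = e), H : run ?c ?d _ |- _ =>
      apply K in H; subst
  end; by [].
Qed.

Definition enc_bool (b : bool) : data := if b then Cons Nil Nil else Nil.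
Definition enc_nat (n : nat) : data := iter n (Cons Nil) Nil.
Definition enc_seq (T : Type) (e : T -> data) (s : seq T) : data :=
  foldr (fun x d => Cons (e x) d) Nil s.

(* The letters of X enter the encodings as formal symbols, through a naming
   c of the letters by numbers; it only has to separate the letters that
   occur in the input. *)
Definition enc_gen (X : Type) (c : X -> nat) (y : gens X) : data :=
  match y with
  | inl x => Cons (enc_bool false) (enc_nat (c x))
  | inr u =>
      Cons (enc_bool true) (enc_seq (fun x => enc_nat (c x)) (fs_seq u))
  end.

Definition enc_letter (X : Type) (c : X -> nat) (l : letter (gens X)) : data :=
  Cons (enc_bool l.2) (enc_gen c l.1).

Definition enc_word (X : Type) (c : X -> nat) (w : word (gens X)) : data :=
  enc_seq (enc_letter c) w.

Definition enc_graph (X : Type) (c : X -> nat)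
    (G : finite_graph (letter (gens X))) : data :=
  Cons (enc_nat (nb_vertices G))
    (enc_seq (fun e => let: (i, l, j) := e in
                Cons (enc_nat i) (Cons (enc_letter c l) (enc_nat j)))
      (edge_list G)).

Fixpoint enc_term (X : Type) (c : X -> nat) (t : term X) : data :=
  match t with
  | TVar x => Cons (enc_nat 0) (enc_nat (c x))
  | TOne => Cons (enc_nat 1) Nil
  | TMul a b => Cons (enc_nat 2) (Cons (enc_term c a) (enc_term c b))
  | TStar a => Cons (enc_nat 3) (enc_term c a)
  | TPlus a => Cons (enc_nat 4) (enc_term c a)
  | TMax a => Cons (enc_nat 5) (enc_term c a)
  end.

Definition word_letters (X : Type) (w : word (gens X)) : seq X :=
  flatten [seq match l.1 with inl x => [:: x] | inr u => fs_seq u end | l <- w].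

Fixpoint term_letters (X : Type) (t : term X) : seq X :=
  match t with
  | TVar x => [:: x]
  | TOne => [::]
  | TMul a b => term_letters a ++ term_letters b
  | TStar a | TPlus a | TMax a => term_letters a
  end.

Definition separates (X : Type) (c : X -> nat) (s : seq X) : Prop :=
  set_inj [set x | List.In x s] c.

(* Decidability of the relation "r u v" between inputs u, v with letters in X;
   [letters] and [enc] list the letters of an input and encode it. *)
Definition decidable_rel (X I : Type) (letters : I -> seq X)
    (enc : (X -> nat) -> I -> data) (r : I -> I -> Prop) : Prop :=
  exists p : prog, forall (u v : I) (c : X -> nat),
    separates c (letters u ++ letters v) ->
    exists2 b : bool, run p (Cons (enc c u) (enc c v)) (enc_bool b) &
      b = true <-> r u v.

Definition sch_graphs_computable (X : Type) (S : inverseMonoidType)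
    (g : gens X -> S) : Prop :=
  exists p : prog, forall (w : word (gens X)) (c : X -> nat),
    separates c (word_letters w) ->
    exists2 G : finite_graph (letter (gens X)),
      run p (enc_word c w) (enc_graph c G) &
      graph_iso G (sch_vertices (word_val g w)) (sch_edges g (word_val g w)).

(* Main.v *)
(* Stephen's procedure for I creates no vertices beyond those of the linear graph
   of the word: the relations only add edges between existing vertices, and
   folding only identifies vertices.  It also respects the height function on the
   vertices of the linear graph that increases along every edge by the length of
   the label.  Heights are bounded, so only finitely many overlined words can
   label edges, and the procedure stops.  As an overlined empty word can be used
   to label the pairs of identified vertices, the whole procedure is a saturation
   of a finite list of edges, which a while loop computes.  Two words are equal in
   I iff each is accepted by the Schuetzenberger graph of the other.

   For FFBR(X), a term determines its trace in the free monoid X^* (its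
   sigma-class) and a word over the generators of I, where the maximum of a
   sigma-class u is read as the overlined u.  Two terms are equal in FFBR(X) iff
   their traces agree and their words are equal in I.  One implication holds
   because the pairs (a, u) in I x X^* with a below the overlined u form an
   F-birestriction monoid.  For the other, I acts on the projections of any
   F-birestriction monoid S by the Munn representation of S, which determines s^+
   and hence s, the product of s^+ and the maximum of its sigma-class. *)

From HB Require Import structures.
Require Import Defs.
From mathcomp Require Import all_boot.
From mathcomp Require Import boolp classical_sets functions cardinality.
Set Implicit Arguments.
Unset Strict Implicit.
Unset Printing Implicit Defensive.

(** * Computable functions on encoded data *)

Notation Node := Defs.Cons.
Notation Leaf := Defs.Nil.

Definition dcomp (f : data -> data) : Prop :=
  exists p, forall d, run p d (f d).

Definition dif (c a b : data) : data := if c is Node _ _ then a else b.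

Lemma dcomp_id : dcomp (fun d => d).
Proof. by exists PId => d; constructor. Qed.

Lemma dcomp_comp f g : dcomp f -> dcomp g -> dcomp (fun d => f (g d)).
Proof.
by move=> [p hp] [q hq]; exists (PSeq q p) => d; apply: run_seq (hq d) (hp _).
Qed.

Lemma dcomp_cons f g : dcomp f -> dcomp g -> dcomp (fun d => Node (f d) (g d)).
Proof. by move=> [p hp] [q hq]; exists (PCons p q) => d; apply: run_cons. Qed.

Lemma dcomp_hd f : dcomp f -> dcomp (fun d => hd (f d)).
Proof. by apply: (@dcomp_comp hd); exists PHd; constructor. Qed.

Lemma dcomp_tl f : dcomp f -> dcomp (fun d => tl (f d)).
Proof. by apply: (@dcomp_comp tl); exists PTl; constructor. Qed.

Lemma dcomp_const c : dcomp (fun=> c).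
Proof.
elim: c => [|a iha b ihb]; last exact: dcomp_cons.
by exists PNil => d; constructor.
Qed.

Lemma dcomp_if c f g :
  dcomp c -> dcomp f -> dcomp g -> dcomp (fun d => dif (c d) (f d) (g d)).
Proof.
move=> [r hr] [p hp] [q hq]; exists (PIf r p q) => d.
case E: (c d) (hr d) => [|a b] h /=.
  exact: run_if_false h (hq d).
exact: run_if_true h (hp d).
Qed.

Ltac dcomp_tac := repeat first
  [ assumption | exact: dcomp_id | exact: dcomp_const
  | apply: dcomp_cons | apply: dcomp_hd | apply: dcomp_tl | apply: dcomp_if
  | match goal with H : dcomp ?g |- dcomp (fun d => ?g _) =>
      apply: (dcomp_comp H) end ].

(** * Structural recursion on trees, run by a loop with an explicit stack *)

Section Para.
Variables z h : data -> data.

Fixpoint para (c d : data) : data :=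
  match d with
  | Leaf => z c
  | Node a b => h (Node c (Node d (Node (para c a) (para c b))))
  end.

(* A state is (context, (tasks, values)).  A task (Leaf, d) asks for the value
   of d; a task (_ , d) with a nonempty tag combines the values of the two
   children of d, found on the top of the value stack. *)
Definition para_step (s : data) : data :=
  let c := hd s in let t := hd (tl s) in let v := tl (tl s) in
  let d := tl (hd t) in
  Node c
    (dif (hd (hd t))
       (Node (tl t)
          (Node (h (Node c (Node d (Node (hd (tl v)) (hd v))))) (tl (tl v))))
       (dif d
          (Node (Node (Node Leaf (hd d))
                   (Node (Node Leaf (tl d))
                      (Node (Node (Node Leaf Leaf) d) (tl t)))) v)
          (Node (tl t) (Node (z c) v)))).

Definition para_test (s : data) : data := hd (tl s).

Hypotheses (hz : dcomp z) (hh : dcomp h).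

Lemma para_step_dcomp : dcomp para_step.
Proof. by rewrite /para_step /=; dcomp_tac. Qed.

Lemma para_test_dcomp : dcomp para_test.
Proof. by rewrite /para_test /=; dcomp_tac. Qed.

(** The language has no recursion, so a while loop repeats [para_step] until the task stack is
    empty. *)
Lemma dcomp_para f g : dcomp f -> dcomp g -> dcomp (fun d => para (f d) (g d)).
Proof.
move=> hf hg.
have [p hp] := para_step_dcomp; have [q hq] := para_test_dcomp.
suff [r hr] : dcomp (fun d => para (hd d) (tl d)).
  suff [r' hr'] : dcomp (fun d => Node (f d) (g d)).
    by exists (PSeq r' r) => d; apply: run_seq (hr' d) (hr (Node _ _)).
  by dcomp_tac.
have [i hi] : dcomp (fun d => Node (hd d) (Node (Node (Node Leaf (tl d)) Leaf) Leaf)).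
  by dcomp_tac.
have [o ho] : dcomp (fun d => hd (tl (tl d))) by dcomp_tac.
have step d d' : (exists a b, para_test d = Node a b) ->
    run (PWhile q p) (para_step d) d' -> run (PWhile q p) d d'.
  move=> [a [b e]]; apply: (@run_while_true q p d a b _ _ _ (hp d)).
  by rewrite -e; apply: hq.
(* In continuation form: a run starting with the value of d on the value stack yields one starting
   with the task d. Arbitrary stacks t and v make the induction apply to both children, and no
   iterations are counted. *)
have main c d t v s : run (PWhile q p) (Node c (Node t (Node (para c d) v))) s ->
    run (PWhile q p) (Node c (Node (Node (Node Leaf d) t) v)) s.
  elim: d t v => [|a iha b ihb] t v hs; apply: (step _ _); try by eexists; eexists.
    exact: hs.
  rewrite /para_step /=; apply/iha/ihb; apply: (step _ _); first by eexists; eexists.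
  exact: hs.
exists (PSeq i (PSeq (PWhile q p) o)) => d.
apply: run_seq (hi d) _.
apply: run_seq (ho (Node (hd d) (Node Leaf (Node (para (hd d) (tl d)) Leaf)))).
by apply: main; apply: run_while_false; apply: (hq (Node _ _)).
Qed.

End Para.

(** * Types with codes in the trees, and the functions computable on them *)

Definition data_eqb : data -> data -> bool :=
  fix eqb a b := match a, b with
  | Leaf, Leaf => true
  | Node a1 a2, Node b1 b2 => eqb a1 b1 && eqb a2 b2
  | _, _ => false end.

Lemma data_eqP : Equality.axiom data_eqb.
Proof.
elim=> [|a1 h1 a2 h2] [|b1 b2] /=; try by constructor.
by apply: (iffP andP) => [[/h1 -> /h2 ->]|[/h1 ? /h2 ?]].
Qed.

HB.instance Definition _ := hasDecEq.Build data data_eqP.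

(** Injectivity lets equality of values be tested on codes. *)
Class Enc (A : Type) := { enc : A -> data; enc_inj : injective enc }.

#[export, refine] Instance Enc_data : Enc data := {| enc := id |}.
Proof. by []. Defined.

#[export, refine] Instance Enc_bool : Enc bool := {| enc := enc_bool |}.
Proof. by move=> [] []. Defined.

#[export, refine] Instance Enc_nat : Enc nat := {| enc := enc_nat |}.
Proof. by elim=> [|m ih] [|n] //= [] /ih <-. Defined.

#[export, refine] Instance Enc_prod A B {eA : Enc A} {eB : Enc B} :
  Enc (A * B) := {| enc p := Node (enc p.1) (enc p.2) |}.
Proof. by move=> [a b] [a' b'] /= [] /(@enc_inj A) -> /(@enc_inj B) ->. Defined.

#[export, refine] Instance Enc_sum A B {eA : Enc A} {eB : Enc B} :
  Enc (A + B) := {| enc s := match s with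
    | inl a => Node (enc_bool false) (enc a)
    | inr b => Node (enc_bool true) (enc b) end |}.
Proof.
by move=> [a|b] [a'|b'] // []; [move/(@enc_inj A) -> | move/(@enc_inj B) ->].
Defined.

#[export, refine] Instance Enc_seq A {eA : Enc A} : Enc (seq A) :=
  {| enc := enc_seq enc |}.
Proof. by elim=> [|a s ih] [|b t] //= [] /(@enc_inj A) -> /ih ->. Defined.

(** The tree function is total, also off the codes, so that composition is immediate. Unbounded
    loops are left to [runs] below. *)
Definition computable (A B : Type) {eA : Enc A} {eB : Enc B} (f : A -> B) :=
  exists2 F, dcomp F & forall a, F (enc a) = enc (f a).

Section Combinators.
Context {A B C D : Type} {eA : Enc A} {eB : Enc B} {eC : Enc C} {eD : Enc D}.

Lemma c_id : computable (fun a : A => a).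
Proof. by exists id => //; apply: dcomp_id. Qed.

Lemma c_const (b : B) : computable (fun _ : A => b).
Proof. by exists (fun=> enc b) => //; apply: dcomp_const. Qed.

Lemma c_comp (g : B -> C) (f : A -> B) :
  computable g -> computable f -> computable (fun a => g (f a)).
Proof.
move=> [G hG eG] [F hF eF]; exists (fun d => G (F d)); first exact: dcomp_comp.
by move=> a; rewrite eF eG.
Qed.

Lemma c_pair (f : A -> B) (g : A -> C) :
  computable f -> computable g -> computable (fun a => (f a, g a)).
Proof.
move=> [F hF eF] [G hG eG]; exists (fun d => Node (F d) (G d)).
  exact: dcomp_cons.
by move=> a; rewrite eF eG.
Qed.

Lemma c_fst (f : A -> B * C) : computable f -> computable (fun a => (f a).1).
Proof.
move=> [F hF eF]; exists (fun d => hd (F d)); first exact: dcomp_hd.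
by move=> a; rewrite eF.
Qed.

Lemma c_snd (f : A -> B * C) : computable f -> computable (fun a => (f a).2).
Proof.
move=> [F hF eF]; exists (fun d => tl (F d)); first exact: dcomp_tl.
by move=> a; rewrite eF.
Qed.

Lemma c_if (b : A -> bool) (f g : A -> B) :
  computable b -> computable f -> computable g ->
  computable (fun a => if b a then f a else g a).
Proof.
move=> [H hH eH] [F hF eF] [G hG eG].
exists (fun d => dif (H d) (F d) (G d)); first exact: dcomp_if.
by move=> a; rewrite eF eG eH; case: (b a).
Qed.

Lemma c_consd (f g : A -> data) :
  computable f -> computable g -> computable (fun a => Node (f a) (g a)).
Proof.
move=> [F hF eF] [G hG eG]; exists (fun d => Node (F d) (G d)).
  exact: dcomp_cons.
by move=> a; rewrite eF eG.
Qed.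

Lemma c_cons (f : A -> B) (g : A -> seq B) :
  computable f -> computable g -> computable (fun a => f a :: g a).
Proof.
move=> [F hF eF] [G hG eG]; exists (fun d => Node (F d) (G d)).
  exact: dcomp_cons.
by move=> a; rewrite eF eG.
Qed.

Lemma c_succ (f : A -> nat) : computable f -> computable (fun a => (f a).+1).
Proof.
move=> [F hF eF]; exists (fun d => Node Leaf (F d)).
  by dcomp_tac.
by move=> a; rewrite eF.
Qed.

Lemma c_inl (f : A -> B) :
  computable f -> computable (fun a => inl (f a) : B + C).
Proof.
move=> [F hF eF]; exists (fun d => Node (enc false) (F d)).
  by dcomp_tac.
by move=> a; rewrite eF.
Qed.

Lemma c_inr (f : A -> C) :
  computable f -> computable (fun a => inr (f a) : B + C).
Proof.
move=> [F hF eF]; exists (fun d => Node (enc true) (F d)).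
  by dcomp_tac.
by move=> a; rewrite eF.
Qed.

Lemma c_sum (s : A -> B + C) (f : A -> B -> D) (g : A -> C -> D) :
  computable s -> computable (fun q : A * B => f q.1 q.2) ->
  computable (fun q : A * C => g q.1 q.2) ->
  computable (fun a => match s a with inl x => f a x | inr y => g a y end).
Proof.
move=> [H hH eH] [F hF eF] [G hG eG].
exists (fun d => dif (hd (H d)) (G (Node d (tl (H d))))
                     (F (Node d (tl (H d))))).
  by dcomp_tac.
move=> a; rewrite eH; case: (s a) => [x|y] /=; first exact: (eF (a, x)).
exact: (eG (a, y)).
Qed.

Lemma c_listrec (F : A -> seq B -> C) (z : A -> C)
    (h : A -> B -> seq B -> C -> C) (s : A -> seq B) :
  (forall a, F a [::] = z a) ->
  (forall a x r, F a (x :: r) = h a x r (F a r)) ->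
  computable z ->
  computable (fun q : A * ((B * seq B) * C) => h q.1 q.2.1.1 q.2.1.2 q.2.2) ->
  computable s -> computable (fun a => F a (s a)).
Proof.
move=> F0 FS [Z hZ eZ] [H hH eH] [S hS eS].
(* The code of the list x :: r is also the code of the pair (x, r). The recursive value at the head
   x is dropped. *)
pose K d := H (Node (hd d) (Node (hd (tl d)) (tl (tl (tl d))))).
exists (fun d => para Z K d (S d)).
  by apply: dcomp_para; rewrite /K; dcomp_tac.
move=> a; rewrite eS; elim: (s a) => [|x r ih] /=; first by rewrite F0 eZ.
by rewrite /K /= ih FS; apply: (eH (a, ((x, r), F a r))).
Qed.

End Combinators.

Lemma c_datarec (C : Type) {eC : Enc C} (F : data -> C) (z : C)
    (h : data -> data -> C -> C -> C) :
  F Leaf = z ->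
  (forall a b, F (Node a b) = h a b (F a) (F b)) ->
  computable (fun q : (data * data) * (C * C) => h q.1.1 q.1.2 q.2.1 q.2.2) ->
  computable F.
Proof.
move=> F0 FS [H hH eH].
exists (fun d => para (fun=> enc z) (fun e => H (tl e)) Leaf d).
  by apply: dcomp_para; dcomp_tac.
elim=> [|a iha b ihb]; rewrite /= ?F0// FS.
move: iha ihb => /= -> ->; exact: (eH ((a, b), (F a, F b))).
Qed.


Ltac comp_step := first
  [ assumption | lazymatch goal with
  | |- computable (fun _ => ?b) => exact: c_const
  | |- computable (fun x => x) => exact: c_id
  | |- computable fst => exact: (c_fst c_id)
  | |- computable snd => exact: (c_snd c_id)
  | |- computable (fun x => (@?f x, @?g x)) => apply: (@c_pair _ _ _ _ _ _ f g)
  | |- computable (fun x => (@?f x).1) => apply: (@c_fst _ _ _ _ _ _ f)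
  | |- computable (fun x => (@?f x).2) => apply: (@c_snd _ _ _ _ _ _ f)
  | |- computable (fun x => @?f x :: @?g x) => apply: (@c_cons _ _ _ _ f g)
  | |- computable (fun x => (@?f x).+1) => apply: (@c_succ _ _ f)
  | |- computable (fun x => inl (@?f x)) => apply: (@c_inl _ _ _ _ _ _ f)
  | |- computable (fun x => inr (@?f x)) => apply: (@c_inr _ _ _ _ _ _ f)
  | |- computable (fun x => Node (@?f x) (@?g x)) => apply: (@c_consd _ _ f g)
  end | simple apply c_if | simple apply c_sum ]; cbn beta.

Ltac comp_tac := repeat comp_step.

Section Derived.
Context {A B C D : Type} {eA : Enc A} {eB : Enc B} {eC : Enc C} {eD : Enc D}.

Lemma c_foldr (h : A -> B -> C -> C) (z : A -> C) (s : A -> seq B) :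
  computable (fun q : A * (B * C) => h q.1 q.2.1 q.2.2) -> computable z ->
  computable s -> computable (fun a => foldr (h a) (z a) (s a)).
Proof.
move=> hh hz hs.
apply: (@c_listrec _ _ _ _ _ _ (fun a => foldr (h a) (z a)) z
  (fun a x _ c => h a x c)) => //.
apply: (c_comp hh (f := fun q : A * ((B * seq B) * C) => (q.1, (q.2.1.1, q.2.2)))).
by comp_tac.
Qed.

Lemma c_nilp (s : A -> seq B) : computable s -> computable (fun a => nilp (s a)).
Proof.
by apply: (@c_listrec _ _ _ _ _ _ (fun _ s => nilp s) (fun=> true)
  (fun _ _ _ _ => false)) => //; comp_tac.
Qed.

Lemma c_map (f : A -> B -> C) (s : A -> seq B) :
  computable (fun q : A * B => f q.1 q.2) -> computable s ->
  computable (fun a => map (f a) (s a)).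
Proof.
move=> hf; apply: (@c_listrec _ _ _ _ _ _ (fun a => map (f a)) (fun=> [::])
  (fun a x _ r => f a x :: r)) => //; comp_tac.
by apply: (c_comp hf (f := fun q : A * ((B * seq B) * seq C) => (q.1, q.2.1.1)));
  comp_tac.
Qed.

Lemma c_cat (s t : A -> seq B) :
  computable s -> computable t -> computable (fun a => s a ++ t a).
Proof.
move=> hs ht; apply: (@c_listrec _ _ _ _ _ _ (fun a x => x ++ t a) t
  (fun a x _ r => x :: r)) => //; comp_tac.
Qed.

End Derived.

Section MoreDerived.
Context {A B : Type} {eA : Enc A} {eB : Enc B}.

Lemma c_flatten (s : A -> seq (seq B)) :
  computable s -> computable (fun a => flatten (s a)).
Proof.
move=> hs; apply: (@c_listrec _ _ _ _ _ _ (fun _ => flatten) (fun=> [::])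
  (fun a x _ r => x ++ r)) => //; comp_tac.
by apply: c_cat; comp_tac.
Qed.

Lemma c_filter (p : A -> B -> bool) (s : A -> seq B) :
  computable (fun q : A * B => p q.1 q.2) -> computable s ->
  computable (fun a => filter (p a) (s a)).
Proof.
move=> hp; apply: (@c_listrec _ _ _ _ _ _ (fun a => filter (p a)) (fun=> [::])
  (fun a x _ r => if p a x then x :: r else r)) => //; comp_tac.
by apply: (c_comp hp (f := fun q : A * ((B * seq B) * seq B) => (q.1, q.2.1.1)));
  comp_tac.
Qed.

Lemma c_has (p : A -> B -> bool) (s : A -> seq B) :
  computable (fun q : A * B => p q.1 q.2) -> computable s ->
  computable (fun a => has (p a) (s a)).
Proof.
move=> hp; apply: (@c_listrec _ _ _ _ _ _ (fun a => has (p a)) (fun=> false)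
  (fun a x _ r => if p a x then true else r)) => //; comp_tac.
by apply: (c_comp hp (f := fun q : A * ((B * seq B) * bool) => (q.1, q.2.1.1)));
  comp_tac.
Qed.

Lemma c_rev (s : A -> seq B) : computable s -> computable (fun a => rev (s a)).
Proof.
move=> hs; apply: (@c_listrec _ _ _ _ _ _ (fun _ => rev) (fun=> [::])
  (fun a x _ r => r ++ [:: x])) => //; comp_tac.
  by move=> _ x r; rewrite rev_cons cats1.
by apply: c_cat; comp_tac.
Qed.

Lemma c_size (s : A -> seq B) : computable s -> computable (fun a => size (s a)).
Proof.
by apply: (@c_listrec _ _ _ _ _ _ (fun _ => size) (fun=> 0)
  (fun a x _ r => r.+1)) => //; comp_tac.
Qed.

Lemma c_behead (s : A -> seq B) :
  computable s -> computable (fun a => behead (s a)).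
Proof.
by apply: (@c_listrec _ _ _ _ _ _ (fun _ => behead) (fun=> [::])
  (fun a x r _ => r)) => //; comp_tac.
Qed.

Lemma c_head (z : A -> B) (s : A -> seq B) :
  computable z -> computable s -> computable (fun a => head (z a) (s a)).
Proof.
move=> hz; apply: (@c_listrec _ _ _ _ _ _ (fun a => head (z a)) z
  (fun a x r _ => x)) => //; comp_tac.
Qed.

Lemma c_neg (b : A -> bool) : computable b -> computable (fun a => ~~ b a).
Proof. by move=> hb; apply: (@c_if _ _ _ _ b (fun=> false) (fun=> true)); comp_tac. Qed.

Lemma c_and (b c : A -> bool) :
  computable b -> computable c -> computable (fun a => b a && c a).
Proof. by move=> hb hc; apply: (@c_if _ _ _ _ b c (fun=> false)); comp_tac. Qed.

Lemma c_eqbool (b c : A -> bool) :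
  computable b -> computable c -> computable (fun a => b a == c a).
Proof.
move=> hb hc; have [F hF eF] : computable (fun a => if b a then c a else ~~ c a).
  by comp_tac; apply: c_neg.
by exists F => // a; rewrite eF; case: (b a) (c a) => -[].
Qed.
End MoreDerived.

(** The preorder code of a tree. [para] recurses on a single tree, so equality of trees is reduced
    to equality of bit lists, which a fold over one list tests while consuming the other. *)
Fixpoint flatten_data (d : data) : seq bool :=
  if d is Node a b then true :: flatten_data a ++ flatten_data b
  else [:: false].

Lemma flatten_data_inj : injective flatten_data.
Proof.
(* No code is a proper prefix of another; the arbitrary remainders r and s let the induction peel
   off one subtree at a time. *)
suff h a b r s : flatten_data a ++ r = flatten_data b ++ s -> a = b /\ r = s.
  by move=> a b e; apply: (proj1 (h a b [::] [::] _)); rewrite e.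
elim: a b r s => [|a1 h1 a2 h2] [|b1 b2] r s //=; first by case.
by case; rewrite -!catA => /h1 [-> /h2 [-> ->]].
Qed.

Lemma c_flatten_data : computable flatten_data.
Proof.
apply: (@c_datarec _ _ flatten_data [:: false]
  (fun _ _ r s => true :: r ++ s)) => //; comp_tac.
by apply: c_cat; comp_tac.
Qed.

Definition strip_step (x : bool) (q : seq bool * bool) : seq bool * bool :=
  (behead q.1, q.2 && (~~ nilp q.1 && (head false q.1 == x))).

(** Folding over the reversed list scans s from the left. The state is the unread part of t with a
    flag for agreement so far. *)
Definition eq_bits (s t : seq bool) : bool :=
  let q := foldr strip_step (t, true) (rev s) in q.2 && nilp q.1.

Lemma eq_bitsE s t : eq_bits s t = (s == t).
Proof.
have -> : eq_bits s t =
    let q := foldl (fun q x => strip_step x q) (t, true) s in q.2 && nilp q.1.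
  by rewrite -[in RHS](revK s) foldl_rev.
rewrite -[RHS]andTb; move: true.
elim: s t => [|x s ih] t b; first by case: t.
rewrite [foldl _ _ _]/= {}ih /strip_step /= -andbA; congr (_ && _).
by case: t => [|y t] //=; rewrite eqseq_cons eq_sym.
Qed.

Section Eq.
Context {A : Type} {B : eqType} {eA : Enc A} {eB : Enc B}.

Lemma c_eq_bits (s t : A -> seq bool) :
  computable s -> computable t -> computable (fun a => eq_bits (s a) (t a)).
Proof.
move=> hs ht; rewrite /eq_bits /=.
have h : computable (fun a => foldr strip_step (t a, true) (rev (s a))).
  apply: (c_foldr (h := fun _ => strip_step)); comp_tac; last exact: c_rev.
  rewrite /strip_step; comp_tac; first by apply: c_behead; comp_tac.
  apply: c_and; comp_tac; apply: c_and.
    by apply: c_neg; apply: c_nilp; comp_tac.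
  by apply: c_eqbool; comp_tac; apply: c_head; comp_tac.
by apply: c_and; comp_tac; apply: c_nilp; comp_tac.
Qed.

Lemma c_eq (f g : A -> B) :
  computable f -> computable g -> computable (fun a => f a == g a).
Proof.
move=> hf hg.
have bits (h : A -> B) : computable h -> computable (fun a => flatten_data (enc (h a))).
  move=> ch; apply: (c_comp c_flatten_data (f := fun a => enc (h a))).
  by case: ch => F hF eF; exists F.
have [F hF eF] := c_eq_bits (bits f hf) (bits g hg); exists F => // a.
by rewrite eF eq_bitsE (inj_eq flatten_data_inj) (inj_eq enc_inj).
Qed.

End Eq.

Lemma c_mem {A : Type} {B : eqType} {eA : Enc A} {eB : Enc B}
    (f : A -> B) (s : A -> seq B) :
  computable f -> computable s -> computable (fun a => f a \in s a).
Proof.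
move=> hf hs; have : computable (fun a => has (fun x => x == f a) (s a)).
  apply: (c_has (p := fun a x => x == f a)) => //.
  by apply: c_eq; comp_tac; apply: (c_comp hf); comp_tac.
by move=> [F hF eF]; exists F => // a; rewrite eF has_pred1.
Qed.
Ltac comp_step2 := first [ comp_step | lazymatch goal with
  | |- computable (fun x => @?f x ++ @?g x) => simple apply c_cat
  | |- computable (fun x => @?f x == @?g x) => simple apply c_eq
  | |- computable (fun x => @?f x \in @?g x) => simple apply c_mem
  | |- computable (fun x => @?f x && @?g x) => simple apply c_and
  | |- computable (fun x => ~~ @?f x) => simple apply c_neg
  | |- computable (fun x => flatten (@?f x)) => simple apply c_flatten
  | |- computable (fun x => size (@?f x)) => simple apply c_size
  | |- computable (fun x => rev (@?f x)) => simple apply c_rev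
  | |- computable (fun x => nilp (@?f x)) => simple apply c_nilp
  | |- computable (fun x => map _ _) => simple apply c_map
  | |- computable (fun x => filter _ _) => simple apply c_filter
  | |- computable (fun x => has _ _) => simple apply c_has
  | |- computable (fun x => foldr _ _ _) => simple apply c_foldr
  end]; cbn beta.

Ltac computability := repeat comp_step2.

(** * Saturation of the linear graph of a word *)

(* Names of generators: [inr u] stands for the overlined word u, and [inr [::]]
   for the identity, so that an [eps]-labelled edge identifies its ends. *)
Definition lab : Type := (data + seq data)%type.
Definition eps : lab := inr [::].
(** The flag marks inverse letters. It comes first, as in [enc_letter], so that a named word has the
    same code as the word itself. *)
Definition lword : Type := seq (bool * lab).

(* an edge (source, (label, target)) *)
Definition fact : Type := (nat * (lab * nat))%type.

(** A partial product, with the empty list for undefined. A plain letter composes only with [eps];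
    in longer products its overlined form takes its place. *)
Definition lcomp (a b : lab) : seq lab :=
  if a == eps then [:: b] else if b == eps then [:: a] else
  match a with
  | inl _ => [::]
  | inr u => match b with inl _ => [::] | inr v => [:: inr (u ++ v)] end
  end.

(** Four rules in turn: overline a letter edge, compose consecutive edges, fold two equally labelled
    edges with a common source, and fold two with a common target. Folding adds an [eps] edge
    instead of merging vertices. *)
Definition conseq (f g : fact) : seq fact :=
  (match f.2.1 with inl x => [:: (f.1, (inr [:: x], f.2.2))] | inr _ => [::] end)
  ++ ((if f.2.2 == g.1 then [seq (f.1, (a, g.2.2)) | a <- lcomp f.2.1 g.2.1]
      else [::])
  ++ ((if (f.1 == g.1) && (f.2.1 == g.2.1) then [:: (f.2.2, (eps, g.2.2))]
      else [::])
  ++ (if (f.2.2 == g.2.2) && (f.2.1 == g.2.1) then [:: (f.1, (eps, g.1))]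
      else [::]))).

Definition new (S : seq fact) : seq fact :=
  [seq h <- flatten [seq flatten [seq conseq f g | g <- S] | f <- S] | ~~ (h \in S)].

Definition step (S : seq fact) : seq fact := S ++ new S.

(** An inverse letter is stored as an edge of its generator in the opposite direction. *)
Definition start_edge (l : bool * lab) (i : nat) : fact :=
  if l.1 then (i, (l.2, i.+1)) else (i.+1, (l.2, i)).

(* The linear graph of w; the vertex between p and q, for w = p ++ q, is
   numbered by the size of q. *)
Fixpoint linear (w : lword) : seq fact :=
  match w with
  | [::] => [:: (0, (eps, 0))]
  | l :: q => ((size q).+1, (eps, (size q).+1)) :: start_edge l (size q) :: linear q
  end.

(** Stated for any predicate, as it describes both the saturated edges and the invariants of the
    saturation. *)
Record closed_edges (P : nat -> lab -> nat -> Prop) : Prop := ClosedEdges {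
  closed_over : forall i j x, P i (inl x) j -> P i (inr [:: x]) j;
  closed_comp : forall i j k a b c,
    P i a j -> P j b k -> c \in lcomp a b -> P i c k;
  closed_det : forall i j k a, P i a j -> P i a k -> P j eps k;
  closed_codet : forall i j k a, P i a k -> P j a k -> P i eps j
}.

Lemma conseq_closed P f g h : closed_edges P ->
  P f.1 f.2.1 f.2.2 -> P g.1 g.2.1 g.2.2 -> h \in conseq f g ->
  P h.1 h.2.1 h.2.2.
Proof.
move: f g => [i [a j]] [i' [b j']] [c1 c2 c3 c4] /= hf hg.
rewrite /conseq !mem_cat /= => /or4P[].
- by case: a hf => // x /c1 hx; rewrite inE => /eqP ->.
- case: eqP => // e /mapP[c hc ->] /=; apply: c2 hf _ hc; by rewrite e.
- case: andP => // -[/eqP e1 /eqP e2]; rewrite inE => /eqP -> /=.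
  by apply: c3 hf _; rewrite e1 e2.
- case: andP => // -[/eqP e1 /eqP e2]; rewrite inE => /eqP -> /=.
  by apply: c4 hf _; rewrite e1 e2.
Qed.

Lemma mem_conseq (S : seq fact) f g h :
  f \in S -> g \in S -> h \in conseq f g -> h \in step S.
Proof.
move=> hf hg hh; rewrite mem_cat; case E: (h \in S) => //=.
rewrite mem_filter E /=; apply/flattenP.
exists (flatten [seq conseq f g | g <- S]); first exact: map_f.
by apply/flattenP; exists (conseq f g) => //; apply: map_f.
Qed.

Lemma new_nil_closed S : new S = [::] ->
  closed_edges (fun i a j => (i, (a, j)) \in S).
Proof.
move=> e; have mem f g h : f \in S -> g \in S -> h \in conseq f g -> h \in S.
  by move=> hf hg /(mem_conseq hf hg); rewrite /step e cats0.
split.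
- by move=> i j x h; apply: (mem _ _ _ h h); rewrite /conseq !mem_cat /=; apply/or4P/Or41; rewrite inE.
- move=> i j k a b c h1 h2 hc; apply: (mem _ _ _ h1 h2).
  rewrite /conseq !mem_cat /= eqxx; apply/or4P/Or42.
  by apply/mapP; exists c.
- move=> i j k a h1 h2; apply: (mem _ _ _ h1 h2).
  rewrite /conseq !mem_cat /= !eqxx; apply/or4P/Or43; exact: mem_head.
- move=> i j k a h1 h2; apply: (mem _ _ _ h1 h2).
  rewrite /conseq !mem_cat /= !eqxx; apply/or4P/Or44; exact: mem_head.
Qed.

Lemma iter_step_ind P S k : closed_edges P ->
  (forall f, f \in S -> P f.1 f.2.1 f.2.2) ->
  forall f, f \in iter k step S -> P f.1 f.2.1 f.2.2.
Proof.
move=> cP h0; elim: k => //= k ih f; rewrite mem_cat => /orP[/ih//|].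
rewrite mem_filter => /andP[_] /flattenP[_ /mapP[g hg ->]].
move=> /flattenP[_ /mapP[g' hg' ->]]; exact: conseq_closed cP (ih _ hg) (ih _ hg').
Qed.

Lemma sub_iter_step S k f : f \in S -> f \in iter k step S.
Proof. by move=> h; elim: k => //= k ih; rewrite mem_cat ih. Qed.

Lemma count_lt (T : eqType) (p q : pred T) x s :
  subpred p q -> x \in s -> q x -> ~~ p x -> count p s < count q s.
Proof.
move=> pq xs qx px; elim: s xs => //= y s ih; rewrite inE => /orP[/eqP <-|/ih h].
  by rewrite qx (negPf px) /= add0n add1n ltnS sub_count.
by rewrite -addnS leq_add//; case: (p y) (pq y) => // ->.
Qed.

(** Each unstable round adds a fact of the finite list U, so the number of facts of U still missing
    drops. *)
Lemma iter_step_stable (U : seq fact) S :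
  (forall k, {subset iter k step S <= U}) ->
  exists k, new (iter k step S) == [::].
Proof.
have [m] := ubnP (count (fun f => f \notin S) U).
elim: m S => // m ih S hm hU; have [|] := boolP (new S == [::]); first by exists 0.
case E: (new S) => [//|h t] _.
have hn : h \in new S by rewrite E inE eqxx.
have [hS hS'] : h \notin S /\ h \in step S.
  by move: (hn); rewrite mem_filter mem_cat hn orbT => /andP[].
have [||k hk] := ih (step S); last by exists k.+1; rewrite iterSr.
  apply: (@leq_trans (count (fun f => f \notin S) U)); last by rewrite -ltnS.
  apply: (count_lt (x := h)) => //.
  - by move=> f; rewrite mem_cat; case: (f \in S).
  - exact: (hU 1).
  - by rewrite negbK.
by move=> k f hf; apply: (hU k.+1); rewrite iterSr.
Qed.

(** * Heights and the termination of the saturation *)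

Definition lab_letters (a : lab) : seq data :=
  match a with inl x => [:: x] | inr u => u end.

Lemma lcomp_letters a b c : c \in lcomp a b ->
  lab_letters c = lab_letters a ++ lab_letters b.
Proof.
rewrite /lcomp; case: eqP => [->|_]; first by rewrite inE => /eqP ->.
case: eqP => [->|_]; first by rewrite inE cats0 => /eqP ->.
by case: a b => // u [] // v; rewrite inE => /eqP ->.
Qed.

Lemma mem_linear w f : f \in linear w ->
  (exists2 i, i <= size w & f = (i, (eps, i))) \/
  (exists p l q, w = p ++ l :: q /\ f = start_edge l (size q)).
Proof.
elim: w => [|l q ih] /=; first by rewrite inE => /eqP ->; left; exists 0.
rewrite !inE => /or3P[/eqP ->|/eqP ->|/ih [[i hi ->]|[p [l' [q' [-> ->]]]]]].
- by left; exists (size q).+1.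
- by right; exists [::], l, q.
- by left; exists i => //; apply: leqW.
- by right; exists (l :: p), l', q'.
Qed.

Lemma linear_vertex w i : i <= size w -> (i, (eps, i)) \in linear w.
Proof.
elim: w => [|l q ih] /=; first by rewrite leqn0 inE => /eqP ->.
by rewrite leq_eqVlt ltnS !inE => /orP[/eqP ->|/ih ->]; rewrite ?eqxx ?orbT.
Qed.

Lemma linear_edge p l q : start_edge l (size q) \in linear (p ++ l :: q).
Proof. by elim: p => [|l' p ih] /=; rewrite !inE ?eqxx ?ih !orbT. Qed.

Fixpoint total (b : bool) (w : lword) : nat :=
  if w is l :: q then
    (if l.1 == b then size (lab_letters l.2) else 0) + total b q
  else 0.

(* Along every edge the height increases by the length of the label.  The offset
   [total false w] keeps the subtraction from truncating. *)
Definition height (w : lword) (i : nat) : nat :=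
  let q := drop (size w - i) w in total false w + total true q - total false q.

Fixpoint seqs_upto (T : Type) (A : seq T) (n : nat) : seq (seq T) :=
  if n is n'.+1 then [::] :: [seq x :: u | x <- A, u <- seqs_upto A n']
  else [:: [::]].

Lemma mem_seqs_upto (T : eqType) (A : seq T) n u :
  {subset u <= A} -> size u <= n -> u \in seqs_upto A n.
Proof.
elim: n u => [|n ih] [|x u] //= hA hn; rewrite ?inE ?eqxx//.
apply/allpairsP; exists (x, u); split=> //=; first by apply: hA; rewrite inE eqxx.
by apply: ih => // y hy; apply: hA; rewrite inE hy orbT.
Qed.

Lemma total_cat b p q : total b (p ++ q) = total b p + total b q.
Proof. by elim: p => //= l p ->; rewrite addnA. Qed.

(** The form without subtraction: the positive letters before the vertex and the inverse letters
    after it are counted. *)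
Lemma height_cat p q :
  height (p ++ q) (size q) = total false p + total true q.
Proof.
rewrite /height size_cat addnK drop_size_cat// total_cat.
by rewrite addnAC addnK.
Qed.

Definition word_data (w : lword) : seq data := flatten [seq lab_letters l.2 | l <- w].

Lemma linear_height w f : f \in linear w ->
  [/\ f.1 <= size w, f.2.2 <= size w, {subset lab_letters f.2.1 <= word_data w} &
      height w f.2.2 = height w f.1 + size (lab_letters f.2.1)].
Proof.
move=> /mem_linear [[i hi ->]|[p [l [q [-> ->]]]]]; first by rewrite /= addn0.
have hs : size q < size (p ++ l :: q) by rewrite size_cat /= addnS ltnS leq_addl.
have hl : {subset lab_letters l.2 <= word_data (p ++ l :: q)}.
  move=> x hx; apply/flattenP; exists (lab_letters l.2) => //.
  by apply: map_f; rewrite mem_cat inE eqxx orbT.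
have e1 := height_cat p (l :: q); have := height_cat (rcons p l) q.
rewrite cat_rcons -cats1 total_cat /= => e2; move: e1 => /=.
rewrite /start_edge; case: l hl {hs} e2 (ltnW hs) (hs) => -[] a /= hl -> h1 h2 ->;
  split=> //; by rewrite ?addn0 -?addnA; congr (_ + _); rewrite addnC.
Qed.

(** Three invariants confine the facts to the finite list U: the ends are vertices of the linear
    graph, the labels use letters of w only, and heights grow by the length of the label. Folded
    vertices have equal heights, so folding preserves the last one. *)
Lemma sat_ex w : exists k, new (iter k step (linear w)) == [::].
Proof.
pose n := size w; pose L := total false w + total true w; pose A := word_data w.
pose labs := [seq inl x | x <- A] ++ [seq inr u | u <- seqs_upto A L] : seq lab.
pose U := [seq (i, q) | i <- iota 0 n.+1,
                        q <- [seq (a, j) | a <- labs, j <- iota 0 n.+1]].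
pose P i a j := [/\ i <= n, j <= n, {subset lab_letters a <= A} &
      height w j = height w i + size (lab_letters a)].
have cP : closed_edges P.
  split.
  - by move=> i j x [].
  - move=> i j k a b c [h1 h2 h3 h4] [h5 h6 h7 h8] /lcomp_letters e; split => //.
      by move=> x; rewrite e mem_cat => /orP[/h3|/h7].
    by rewrite h8 h4 e size_cat addnA.
  - by move=> i j k a [h1 h2 h3 h4] [h5 h6 h7 h8]; split => //; rewrite h4 h8 addn0.
  - move=> i j k a [h1 h2 h3 h4] [h5 h6 h7 h8]; split => //=.
    by rewrite addn0; apply/eqP; rewrite -(eqn_add2r (size (lab_letters a))) -h4 h8.
apply: (@iter_step_stable U) => k f.
move=> /(iter_step_ind cP (@linear_height w)); case: f => i [a j] [/= h1 h2 h3 h4].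
apply: allpairs_f; first by rewrite mem_iota.
apply: allpairs_f; last by rewrite mem_iota.
rewrite mem_cat; case: a h3 h4 => [x|u] /= h3 h4; apply/orP.
  by left; apply: map_f; apply: h3; rewrite inE.
right; apply: map_f; apply: mem_seqs_upto => //.
(* Heights are natural numbers, so the length of u is at most the height of the target, which is at
   most L. *)
apply: leq_trans (_ : height w j <= _); first by rewrite h4 leq_addl.
rewrite /height leq_subLR; apply: (@leq_trans L); last exact: leq_addl.
rewrite leq_add2l -{3}(cat_take_drop (size w - j) w) total_cat; exact: leq_addl.
Qed.

Definition sat (w : lword) : seq fact := iter (ex_minn (sat_ex w)) step (linear w).

Lemma sat_closed w : closed_edges (fun i a j => (i, (a, j)) \in sat w).
Proof. by apply: new_nil_closed; rewrite /sat; case: ex_minnP => k /eqP. Qed.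

Lemma sat_linear w f : f \in linear w -> f \in sat w.
Proof. exact: sub_iter_step. Qed.

Lemma sat_ind w P : closed_edges P ->
  (forall f, f \in linear w -> P f.1 f.2.1 f.2.2) ->
  forall i a j, (i, (a, j)) \in sat w -> P i a j.
Proof. by move=> cP h i a j /(iter_step_ind cP h). Qed.

(** * Programs for the saturation, for acceptance and for the quotient graph *)

Lemma c_lcomp (A : Type) (eA : Enc A) (f g : A -> lab) :
  computable f -> computable g -> computable (fun a => lcomp (f a) (g a)).
Proof.
move=> hf hg; rewrite /lcomp; computability.
all: try by apply: (c_comp hf); computability.
all: by apply: (c_comp hg); computability.
Qed.

Lemma c_conseq (A : Type) (eA : Enc A) (f g : A -> fact) :
  computable f -> computable g -> computable (fun a => conseq (f a) (g a)).
Proof.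
move=> hf hg; rewrite /conseq; computability.
all: try by apply: (c_comp hf); computability.
all: try by apply: (c_comp hg); computability.
by apply: c_lcomp; computability.
Qed.

Lemma c_new : computable new.
Proof. by rewrite /new; computability; apply: c_conseq; computability. Qed.

Lemma c_step : computable step.
Proof. by rewrite /step; computability; apply: c_new. Qed.

Lemma c_linear : computable linear.
Proof.
apply: (@c_listrec lword _ _ _ _ _ (fun=> linear) (fun=> linear [::])
  (fun _ l q c => ((size q).+1, (eps, (size q).+1)) :: start_edge l (size q) :: c)
  (fun w => w)) => //; rewrite /start_edge; computability.
Qed.

(** Weaker than [computable]: nothing is asked of the program off the codes, where a while loop need
    not stop. *)
Definition runs (A B : Type) {eA : Enc A} {eB : Enc B} (f : A -> B) : Prop :=
  exists p, forall a, run p (enc a) (enc (f a)).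

Lemma computable_runs (A B : Type) {eA : Enc A} {eB : Enc B} (f : A -> B) :
  computable f -> runs f.
Proof. by move=> [F [p hp] eF]; exists p => a; rewrite -eF. Qed.

Lemma runs_comp (A B C : Type) {eA : Enc A} {eB : Enc B} {eC : Enc C}
    (g : B -> C) (f : A -> B) : runs g -> runs f -> runs (fun a => g (f a)).
Proof.
by move=> [q hq] [p hp]; exists (PSeq p q) => a; apply: run_seq (hp a) (hq _).
Qed.

Lemma runs_pair (A B C : Type) {eA : Enc A} {eB : Enc B} {eC : Enc C}
    (f : A -> B) (g : A -> C) : runs f -> runs g -> runs (fun a => (f a, g a)).
Proof. by move=> [q hq] [p hp]; exists (PCons q p) => a; apply: run_cons. Qed.

Lemma runs_sat : runs sat.
Proof.
have [i hi] := computable_runs c_linear; have [q hq] := computable_runs c_new.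
(* The program for [new] is the loop test, as the empty list is coded by [Leaf], which counts as
   false. *)
have [p hp] := computable_runs c_step; exists (PSeq i (PWhile q p)) => w.
apply: run_seq (hi w) _; rewrite /sat; case: ex_minnP => k + _.
elim: k (linear w) => [|k ih] S hk.
  by apply: run_while_false; have := hq S; move/eqP: (hk) => /= ->.
case E: (new S) => [|f t].
  (* A stable list is a fixed point of [step], so stopping here gives the same result as the
     remaining rounds. *)
  have -> : iter k.+1 step S = S by apply: iter_fix; rewrite /step E cats0.
  by apply: run_while_false; have := hq S; rewrite E.
rewrite iterSr; apply: run_while_true (hp S) (ih _ _); last by rewrite -iterSr.
have := hq S; rewrite E; apply.
Qed.

Definition back (S : seq fact) (l : bool * lab) (V : seq nat) : seq nat :=
  [seq (if l.1 then f.2.2 else f.1) |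
     f <- [seq f <- S | (f.2.1 == l.2) && ((if l.1 then f.1 else f.2.2) \in V)]].

(** The word v is read backwards from the end vertex 0, keeping the set of possible sources; the
    start vertex is [size w]. The final [eps] admits all vertices identified with 0. *)
Definition accepts (w v : lword) : bool :=
  size w \in foldr (back (sat w)) [:: 0] (v ++ [:: (false, eps)]).

Lemma runs_accepts : runs (fun q : lword * lword => accepts q.1 q.2).
Proof.
have h : computable (fun q : seq fact * (nat * lword) =>
   q.2.1 \in foldr (back q.1) [:: 0] (q.2.2 ++ [:: (false, eps)])).
  by computability; rewrite /back; computability.
apply: (runs_comp (computable_runs h)
  (f := fun q : lword * lword => (sat q.1, (size q.1, q.2)))).
apply: runs_pair; last by apply: computable_runs; computability.
by apply: (runs_comp runs_sat); apply: computable_runs; computability.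
Qed.

(** Keeps the last member of each class of identified vertices. *)
Fixpoint undup_eps (S : seq fact) (s : seq nat) : seq nat :=
  if s is i :: r then
    if has (fun j => (i, (eps, j)) \in S) r then undup_eps S r
    else i :: undup_eps S r
  else [::].

Lemma mem_undup_eps S r i : i \in undup_eps S r -> i \in r.
Proof.
elim: r => //= j r ih; case: ifP => _; rewrite !inE; first by move/ih->; rewrite orbT.
by move=> /orP[->//|/ih ->]; rewrite orbT.
Qed.

Definition vertices (S : seq fact) : seq nat := undup_eps S [seq f.1 | f <- S].

(** The nesting of the pairs is that of [enc_graph]. *)
Definition lgraph : Type := (nat * seq (nat * ((bool * lab) * nat)))%type.

(** One representative per class is enough, since a saturated list is closed under replacing the
    ends of an edge by identified vertices. Each edge is listed with its inverse, and [eps] is no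
    generator. *)
Definition quotient_graph (S : seq fact) (V : seq nat) : lgraph :=
  (size V, flatten [seq
     if (f.1 \in V) && ((f.2.2 \in V) && ~~ (f.2.1 == eps)) then
       [:: (index f.1 V, ((false, f.2.1), index f.2.2 V));
           (index f.2.2 V, ((true, f.2.1), index f.1 V))]
     else [::] | f <- S]).

Definition sch_graph (w : lword) : lgraph :=
  quotient_graph (sat w) (vertices (sat w)).

Lemma c_index (A : Type) {eA : Enc A} (i : A -> nat) (s : A -> seq nat) :
  computable i -> computable s -> computable (fun a => index (i a) (s a)).
Proof.
move=> hi hs; apply: (@c_listrec _ _ _ _ _ _ (fun a => index (i a)) (fun=> 0)
  (fun a x _ n => if x == i a then 0 else n.+1) s) => //; computability.
by apply: (c_comp hi); computability.
Qed.

Lemma runs_sch_graph : runs sch_graph.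
Proof.
have h : computable (fun S => quotient_graph S (vertices S)).
  rewrite /vertices; apply: (@c_comp _ _ _ _ _ _
    (fun q : seq fact * seq nat => quotient_graph q.1 q.2)
    (fun S => (S, undup_eps S [seq f.1 | f <- S]))).
    by rewrite /quotient_graph; computability; apply: c_index; computability.
  apply: c_pair; first by computability.
  apply: (@c_listrec _ _ _ _ _ _ undup_eps (fun=> [::])
    (fun S i r c => if has (fun j => (i, (eps, j)) \in S) r then c else i :: c)
    (fun S => [seq f.1 | f <- S])) => //; computability.
  by apply: (@c_mem _ fact); computability.
exact: (runs_comp (computable_runs h) runs_sat).
Qed.

(** * Inverse monoids and graphs of partial injections *)

Local Open Scope group_scope.

Section InverseMonoid.
Context {S : inverseMonoidType}.
Implicit Types a b p q : S.

Lemma invm1 : (1 : S)^-1 = 1.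
Proof. by rewrite -[LHS]mulg1 -[X in _ * X]invgK -invgM mulg1 invgK. Qed.

Lemma invm_regular a : a * (a^-1 * a) = a.
Proof. by rewrite mulgA mulgVg. Qed.

Lemma invm_comm a b : a * a^-1 * (b^-1 * b) = b^-1 * b * (a * a^-1).
Proof. by have := mulgVC a b^-1; rewrite invgK. Qed.

Lemma invm_commV a b : a^-1 * a * (b^-1 * b) = b^-1 * b * (a^-1 * a).
Proof. by have := mulgVC a^-1 b^-1; rewrite !invgK. Qed.

Definition inv_le a b : Prop := a = b * (a^-1 * a).


Lemma inv_le_inv a b : inv_le a b -> a^-1 = a^-1 * a * b^-1.
Proof. by move=> {1}->; rewrite invgM invgM invgK. Qed.

(** Commuting idempotents turn the restriction of b on the right into one on the left. *)
Lemma inv_leE a b : inv_le a b -> a * a^-1 * b = a.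
Proof.
move=> h; rewrite (inv_le_inv h).
have -> : a * (a^-1 * a * b^-1) * b = a * (a^-1 * a) * (b^-1 * b).
  by rewrite !mulgA.
rewrite invm_regular; transitivity (b * (a^-1 * a) * (b^-1 * b)).
  by rewrite -h.
by rewrite -mulgA invm_commV !mulgA mulgVg -mulgA -h.
Qed.

Lemma inv_leEr a b : a * a^-1 * b = a -> inv_le a b.
Proof.
move=> h; have hV : a^-1 = b^-1 * (a * a^-1) by rewrite -{1}h !invgM invgK.
rewrite /inv_le hV -(mulgA b^-1) mulgVg.
transitivity (b * b^-1 * (a * a^-1 * b)); last by rewrite h mulgA.
by rewrite mulgA mulgVC -mulgA mulgVg.
Qed.

Lemma inv_le_refl a : inv_le a a.
Proof. by rewrite /inv_le invm_regular. Qed.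

(* [conn a p q]: an edge p -a-> q of a Schuetzenberger graph *)
Definition conn a p q : Prop := q = p * a /\ p = q * a^-1.

Lemma conn1 p : conn 1 p p.
Proof. by rewrite /conn invm1 !mulg1. Qed.

Lemma conn_mul a b p q r : conn a p q -> conn b q r -> conn (a * b) p r.
Proof.
by move=> [h1 h2] [h3 h4]; split; rewrite ?invgM mulgA -?h1 -?h4.
Qed.

Lemma conn_inv a p q : conn a p q -> conn a^-1 q p.
Proof. by move=> [h1 h2]; split; rewrite ?invgK. Qed.

Lemma conn_det a p q r : conn a p q -> conn a p r -> q = r.
Proof. by move=> [-> _] [-> _]. Qed.

Lemma conn_codet a p q r : conn a p r -> conn a q r -> p = q.
Proof. by move=> [_ ->] [_ ->]. Qed.

(** The source p absorbs a a^-1, and a a^-1 b = a, so b moves p as a does; dually for the target and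
    the inverses. *)
Lemma conn_le a b p q : inv_le a b -> conn a p q -> conn b p q.
Proof.
move=> h [e1 e2]; split.
  by rewrite {1}e1 -{1}(inv_leE h) !mulgA -e1 -e2.
by rewrite {1}e2 (inv_le_inv h) !mulgA -e2 -e1.
Qed.

Lemma conn_R a p q : conn a p q -> q * q^-1 = p * p^-1.
Proof.
by move=> [e1 e2]; rewrite [in LHS]e1 invgM mulgA -e1 -e2.
Qed.

Lemma inv_le1 a : inv_le (a^-1 * a) 1.
Proof. by rewrite /inv_le invgM invgK mul1g -!mulgA !invm_regular. Qed.

Lemma inv_leV1 a : inv_le (a * a^-1) 1.
Proof. by have := inv_le1 a^-1; rewrite invgK. Qed.

Lemma inv_le_trans a b c : inv_le a b -> inv_le b c -> inv_le a c.
Proof.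
move=> h1 h2; apply: inv_leEr.
have e : a * a^-1 * (b * b^-1) = a * a^-1.
  by rewrite mulgA (inv_leE h1) [in RHS](inv_le_inv h1) mulgA invm_regular.
by rewrite -e -(mulgA _ (b * b^-1)) inv_leE// inv_leE.
Qed.

Lemma inv_le_mull a b c : inv_le a b -> inv_le (c * a) (c * b).
Proof.
move=> h; apply: inv_leEr.
transitivity (c * (a * a^-1 * (c^-1 * c)) * b); first by rewrite invgM !mulgA.
by rewrite invm_comm mulgA invm_regular -mulgA inv_leE.
Qed.

Lemma inv_le_inv2 a b : inv_le a b -> inv_le a^-1 b^-1.
Proof.
by move=> h; apply: inv_leEr; rewrite invgK -inv_le_inv.
Qed.

Lemma inv_le_mulr a b c : inv_le a b -> inv_le (a * c) (b * c).
Proof.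
move=> /inv_le_inv2 h; have := inv_le_inv2 (inv_le_mull (c^-1) h).
by rewrite !invgM !invgK.
Qed.

Lemma inv_le_mul a b c d : inv_le a b -> inv_le c d -> inv_le (a * c) (b * d).
Proof.
move=> h1 h2; exact: inv_le_trans (inv_le_mulr c h1) (inv_le_mull b h2).
Qed.

Lemma inv_le_antisym a b : inv_le a b -> inv_le b a -> a = b.
Proof.
move=> h1 h2; rewrite h1; transitivity (b * (b^-1 * b) * (a^-1 * a)).
  by rewrite invm_regular.
by rewrite -mulgA invm_commV mulgA -h1 -h2.
Qed.

End InverseMonoid.

(** * Inverse monoids acting on graphs by partial injections *)

Section GraphPaths.
Context {Y Q : Type} (E : Q -> Y -> Q -> Prop) (eqv : Q -> Q -> Prop).

Definition edge (p : Q) (l : letter Y) (q : Q) : Prop :=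
  if l.2 then E q l.1 p else E p l.1 q.

Fixpoint reads (w : word Y) (p q : Q) : Prop :=
  if w is l :: w' then exists2 r, edge p l r & reads w' r q else eqv p q.

(* Graphs of partial injections on the classes of a partial equivalence. *)
Record inverse_graph : Prop := InverseGraph {
  eqv_sym : forall p q, eqv p q -> eqv q p;
  eqv_trans : forall p q r, eqv p q -> eqv q r -> eqv p r;
  eqv_edge : forall p p' y q q',
    eqv p' p -> E p y q -> eqv q q' -> E p' y q';
  edge_det : forall p y q q', E p y q -> E p y q' -> eqv q q';
  edge_codet : forall p p' y q, E p y q -> E p' y q -> eqv p p'
}.

Hypothesis G : inverse_graph.

Lemma edge_eqv p p' l q q' : eqv p' p -> edge p l q -> eqv q q' -> edge p' l q'.
Proof.
case: l => y [] h1 h2 h3; rewrite /edge /=; last exact: (eqv_edge G h1 h2 h3).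
apply: (eqv_edge G _ h2 _); exact: (eqv_sym G).
Qed.

Lemma edge_refl p l q : edge p l q -> eqv p p /\ eqv q q.
Proof.
by case: l => y [] h; split; (exact: (edge_det G h h) || exact: (edge_codet G h h)).
Qed.

Lemma edge_letter_det p l q q' : edge p l q -> edge p l q' -> eqv q q'.
Proof. by case: l => y []; [apply: (edge_codet G) | apply: (edge_det G)]. Qed.

Lemma reads_eqv w p p' q q' : eqv p' p -> reads w p q -> eqv q q' -> reads w p' q'.
Proof.
elim: w p p' => [|l w ih] p p' /= h1 h2 h3.
  exact: (eqv_trans G h1 (eqv_trans G h2 h3)).
have [r hr hw] := h2; have [_ rr] := edge_refl hr.
exists r; [exact: edge_eqv h1 hr rr | exact: ih rr hw h3].
Qed.

Lemma reads_refl w p q : reads w p q -> eqv p p /\ eqv q q.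
Proof.
elim: w p => [|l w ih] p /=.
  by move=> h; have h' := eqv_sym G h; split; apply: (eqv_trans G); eassumption.
by move=> [r /edge_refl [pp _] /ih []].
Qed.

Lemma reads_cat u v p q : reads (u ++ v) p q <-> exists2 r, reads u p r & reads v r q.
Proof.
elim: u p => [|l u ih] p /=; split.
- by move=> h; exists p => //; case: (reads_refl h).
- by move=> [r h1 h2]; apply: (reads_eqv h1 h2); case: (reads_refl h2).
- by move=> [r h1 /ih [s h2 h3]]; exists s => //; exists r.
- by move=> [s [r h1 h2] h3]; exists r => //; apply/ih; exists s.
Qed.

Lemma reads1 l p q : reads [:: l] p q <-> edge p l q.
Proof.
split=> [[r h1 /= h2]|h]; last by exists q => //=; case: (edge_refl h).
by apply: (edge_eqv _ h1 h2); case: (edge_refl h1).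
Qed.

Lemma reads_word_inv u p q : reads (word_inv u) p q <-> reads u q p.
Proof.
suff h v a b : reads v a b -> reads (word_inv v) b a.
  by split=> /h //; rewrite word_invK.
elim: v a => [|l v ih] a /=; first exact: (eqv_sym G).
move=> [r h1 /ih h2]; rewrite /word_inv /= rev_cons -cats1; apply/reads_cat.
exists r => //; apply/reads1; move: h1.
by case: l => y [].
Qed.

Lemma reads_det u p q q' : reads u p q -> reads u p q' -> eqv q q'.
Proof.
elim: u p => [|l u ih] p /=.
  by move=> /(eqv_sym G); apply: (eqv_trans G).
move=> [r h1 h2] [s h3 h4]; apply: (ih r h2).
have e := edge_letter_det h1 h3; apply: (reads_eqv e h4).
by case: (reads_refl h4).
Qed.

Lemma reads_codet u p p' q : reads u p q -> reads u p' q -> eqv p p'.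
Proof. by move=> /reads_word_inv h1 /reads_word_inv; apply: reads_det. Qed.

(** Idempotents act as partial identities; this is why they commute in [reads_cong]. *)
Lemma reads_loop u p q :
  reads (u ++ word_inv u) p q <-> eqv p q /\ exists r, reads u p r.
Proof.
split=> [/reads_cat [r h1 /reads_word_inv h2]|[h1 [r h2]]].
  by split; [apply: reads_codet h1 h2 | exists r].
apply/reads_cat; exists r => //; apply/reads_word_inv.
by apply: (reads_eqv (eqv_sym G h1) h2); case: (reads_refl h2).
Qed.

(** As b-paths are a-paths, reading b^-1 after a leads back to the start of the a-path by
    codeterminism, so a b^-1 b traces just b. *)
Lemma reads_rel_ge a b :
  (forall p q, reads b p q -> reads a p q) ->
  forall p q, reads b p q <-> reads (a ++ word_inv b ++ b) p q.
Proof.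
move=> h p q; split=> [hb|].
  apply/reads_cat; exists q; first exact: h.
  by apply/reads_cat; exists p => //; apply/reads_word_inv.
move=> /reads_cat [r h1 /reads_cat [s /reads_word_inv h2 h3]].
have sp : eqv p s := reads_codet h1 (h _ _ h2).
by apply: (reads_eqv sp h3); case: (reads_refl h3).
Qed.

(** Partial injections form an inverse monoid, so only the relations in R have to be checked on the
    graph. *)
Theorem reads_cong (R : word Y -> word Y -> Prop) :
  (forall u v, R u v -> forall p q, reads u p q <-> reads v p q) ->
  forall u v, inv_cong R u v -> forall p q, reads u p q <-> reads v p q.
Proof.
move=> hR u v; elim=> {u v} //.
- by move=> u v _ h p q; rewrite h.
- by move=> u v w _ h _ h' p q; rewrite h h'.
- move=> u u' v v' _ h _ h' p q; rewrite !reads_cat.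
  by split=> -[r /h h1 /h' h2]; exists r.
- by move=> u v _ h p q; rewrite !reads_word_inv.
- move=> u p q; split=> [/reads_cat [r h1 /reads_cat [s /reads_word_inv h2 h3]]|h].
    by apply: (reads_eqv (reads_codet h1 h2) h3); case: (reads_refl h3).
  apply/reads_cat; exists q => //; apply/reads_cat.
  by exists p => //; apply/reads_word_inv.
- suff sw u v p q : reads ((u ++ word_inv u) ++ (v ++ word_inv v)) p q ->
      reads ((v ++ word_inv v) ++ (u ++ word_inv u)) p q by move=> u v p q; split; apply: sw.
  move=> /reads_cat [r /reads_loop [pr [s hs]] /reads_loop [rq [t ht]]].
  apply/reads_cat; exists r; apply/reads_loop; split=> //.
    by exists t; apply: (reads_eqv pr ht); case: (reads_refl ht).
  by exists s; apply: (reads_eqv (eqv_sym G pr) hs); case: (reads_refl hs).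
Qed.

End GraphPaths.

(** * Schuetzenberger graphs *)

Section MonoidI.
Context {X : Type}.
Notation I := (monoid_I X).
Notation gen := (@gen_I X).

Lemma gen_I_eq u v : word_val gen u = word_val gen v <-> inv_cong (@rel_I X) u v.
Proof. by rewrite !inv_word_val inv_classP. Qed.

Lemma word_ge_le (a b : word (gens X)) :
  let r := word_ge a b in
  rel_I r.1 r.2 -> inv_le (word_val gen b) (word_val gen a).
Proof.
move=> r /ic_rel/gen_I_eq; rewrite /r /= !word_val_cat word_val_inv => h.
by rewrite /inv_le {1}h.
Qed.

(** Sending the empty word to 1 matches the reading of [eps] and frees [over_val_mul] from a
    condition of non-emptiness. *)
Definition over_val (u : seq X) : I :=
  if u is x :: u' then gen (inr (x, u')) else 1.

Lemma letter_le x : inv_le (gen (inl x)) (over_val [:: x]).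
Proof. by have := word_ge_le (rel_I_letter x); rewrite /= !mulg1. Qed.

Lemma over_val_mul u v : inv_le (over_val u * over_val v) (over_val (u ++ v)).
Proof.
case: u => [|x u] /=; first by rewrite mul1g; apply: inv_le_refl.
case: v => [|y v] /=; first by rewrite mulg1 cats0; apply: inv_le_refl.
by have := word_ge_le (rel_I_cat (x, u) (y, v)); rewrite /= !mulg1.
Qed.

End MonoidI.

(** Places the letters of a word as edges in its Schuetzenberger graph. As s^-1 ends in a^-1 p^-1
    and the idempotents p^-1 p and a a^-1 commute, a^-1 undoes the step along a. *)
Lemma conn_prefix (S : inverseMonoidType) (p a q s : S) : s = p * a * q ->
  conn a (s * s^-1 * p) (s * s^-1 * (p * a)).
Proof.
move=> hs; split; first by rewrite !mulgA.
have -> : s^-1 = q^-1 * a^-1 * p^-1 by rewrite hs !invgM mulgA.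
rewrite -!mulgA; congr (_ * (_ * _)).
transitivity (a^-1 * (p^-1 * p * (a * a^-1))); last by rewrite !mulgA.
by have := mulgVg a^-1; rewrite invgK -invm_comm !mulgA => ->.
Qed.

Section Names.
Context {X : Type} (n : X -> data) (d : data -> X).
Notation I := (monoid_I X).
Notation gen := (@gen_I X).

Definition name (y : gens X) : lab :=
  match y with inl x => inl (n x) | inr u => inr (map n (fs_seq u)) end.

(* The value at [eps], which names no generator, is irrelevant. *)
Definition unname (a : lab) : gens X :=
  match a with
  | inl x => inl (d x)
  | inr [::] => inl (d Leaf)
  | inr (x :: u) => inr (d x, map d u)
  end.

(** The map d inverts n only on the letters of the input, so this is required generator by
    generator. *)
Definition named (y : gens X) : Prop := unname (name y) = y.

Definition name_word (w : word (gens X)) : lword := [seq (l.2, name l.1) | l <- w].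

Definition all_named (w : word (gens X)) : Prop :=
  foldr (fun l P => named l.1 /\ P) True w.

Definition lab_val (a : lab) : I :=
  match a with inl x => gen (inl (d x)) | inr u => over_val (map d u) end.

Lemma lab_valE a : a != eps -> lab_val a = gen (unname a).
Proof. by case: a => [x|[|x u]]. Qed.

Lemma name_neq_eps y : name y != eps.
Proof. by case: y => [x|[x u]]. Qed.

Lemma lab_val_name y : named y -> lab_val (name y) = gen y.
Proof. by move=> h; rewrite lab_valE ?name_neq_eps// h. Qed.

Lemma lcomp_val a b c :
  c \in lcomp a b -> inv_le (lab_val a * lab_val b) (lab_val c).
Proof.
rewrite /lcomp; case: eqP => [->|_].
  by rewrite inE => /eqP ->; rewrite mul1g; apply: inv_le_refl.
case: eqP => [->|_].
  by rewrite inE => /eqP ->; rewrite mulg1; apply: inv_le_refl.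
case: a b => [x|u] [y|v] //; rewrite inE => /eqP -> /=.
by rewrite map_cat; apply: over_val_mul.
Qed.

Lemma unnameK a : a != eps -> (forall x, x \in lab_letters a -> n (d x) = x) ->
  name (unname a) = a.
Proof.
case: a => [x|[|x u]] //= _ h; first by rewrite h ?inE.
rewrite /fs_seq /= h ?mem_head// -map_comp; congr (inr (_ :: _)).
by rewrite -[RHS]map_id; apply/eq_in_map => y hy /=; rewrite h// inE hy orbT.
Qed.

Lemma named_letters y x : named y -> x \in lab_letters (name y) -> n (d x) = x.
Proof.
case: y => [y|[y u]] [] /=; first by move=> h; rewrite inE => /eqP ->; rewrite h.
move=> hy hu; rewrite inE => /orP[/eqP ->|]; first by rewrite hy.
elim: u hu => //= z u ih [hz /ih hu]; rewrite inE => /orP[/eqP ->|/hu//].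
by rewrite hz.
Qed.

Lemma name_word_split w p' l' q' : name_word w = p' ++ l' :: q' ->
  exists p l q, [/\ w = p ++ l :: q, l' = (l.2, name l.1) & size q' = size q].
Proof.
elim: w p' => [|l w ih] [|l0 p'] //= [].
  by move=> <- <-; exists [::], l, w; rewrite size_map.
by move=> _ /ih [p [l1 [q [-> -> ->]]]]; exists (l :: p), l1, q.
Qed.

(** * The saturated graph of a word against its Schuetzenberger graph *)

Section Graph.
Variable w : word (gens X).
Hypothesis w_named : all_named w.
Notation W := (name_word w).
Notation s := (word_val gen w).

(** The element of the R-class of s reached from s s^-1 by the prefix of w whose remaining suffix
    has size i. *)
Definition vtx (i : nat) : I := s * s^-1 * word_val gen (take (size w - i) w).

Lemma vtx_cat p q : w = p ++ q -> vtx (size q) = s * s^-1 * word_val gen p.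
Proof. by move=> e; rewrite /vtx e size_cat addnK take_size_cat. Qed.

Lemma vtx_start : vtx (size w) = s * s^-1.
Proof. by rewrite (@vtx_cat [::])//= mulg1. Qed.

Lemma vtx_end : vtx 0 = s.
Proof. by rewrite (@vtx_cat w [::]) ?cats0//= mulgVg. Qed.

Lemma all_named_cat p q : all_named (p ++ q) <-> all_named p /\ all_named q.
Proof. by elim: p => [|l p ih] /=; [split=> // -[] | rewrite ih; tauto]. Qed.

Definition lab_conn (i : nat) (a : lab) (j : nat) : Prop :=
  conn (lab_val a) (vtx i) (vtx j).

(** The first two rules hold by the defining relations of I, the folding rules because [conn a] is a
    partial injection. *)
Lemma lab_conn_closed : closed_edges lab_conn.
Proof.
split; rewrite /lab_conn.
- by move=> i j x; apply: conn_le; apply: letter_le.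
- move=> i j k a b c h1 h2 /lcomp_val h; apply: (conn_le h); exact: conn_mul h1 h2.
- by move=> i j k a h1 h2; rewrite (conn_det h1 h2); apply: conn1.
- by move=> i j k a h1 h2; rewrite (conn_codet h1 h2); apply: conn1.
Qed.

(** Soundness of the saturation: the linear edges hold in the R-class of s by [conn_prefix], and the
    rules preserve this. *)
Lemma sat_conn i a j : (i, (a, j)) \in sat W -> lab_conn i a j.
Proof.
apply: (sat_ind lab_conn_closed) => f /mem_linear [[k _ ->]|]; first exact: conn1.
move=> [p' [l' [q' [e ->]]]].
have [p [l [q [ew -> ->]]]] := name_word_split e.
have hl : named l.1 by move: w_named; rewrite ew => /all_named_cat [_ []].
have h : conn (letter_val gen l) (vtx (size q).+1) (vtx (size q)).
  rewrite (@vtx_cat p (l :: q))// (@vtx_cat (rcons p l) q) ?cat_rcons//.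
  rewrite -cats1 word_val_cat /= mulg1; apply: conn_prefix.
  by rewrite {1}ew word_val_cat /= mulgA.
case: l hl h {ew} => y [] /= hy; rewrite /start_edge /letter_val /lab_conn /=.
  by move/conn_inv; rewrite invgK lab_val_name.
by rewrite lab_val_name.
Qed.

Definition gedge (i : nat) (y : gens X) (j : nat) : Prop :=
  named y /\ (i, (name y, j)) \in sat W.
Definition same (i j : nat) : Prop := (i, (eps, j)) \in sat W.

Lemma gedge_inverse : inverse_graph gedge same.
Proof.
have [c1 c2 c3 c4] := sat_closed W.
split; rewrite /same /gedge.
(* Folding h with itself gives the loop at i, and folding h with that loop reverses it. *)
- by move=> i j h; apply: c3 h (c4 _ _ _ _ h h).
- by move=> i j k h1 h2; apply: (c2 _ _ _ _ _ _ h1 h2); rewrite inE.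
- move=> i i' y j j' h1 [hy h2] h3; split=> //; apply: (c2 _ _ _ _ (name y) _ h1).
    by apply: (c2 _ _ _ _ _ _ h2 h3); rewrite /lcomp (negPf (name_neq_eps y)) eqxx mem_head.
  by rewrite /lcomp eqxx mem_head.
- by move=> i y j k [_ h1] [_]; apply: c3.
- by move=> i j y k [_ h1] [_]; apply: c4.
Qed.

Notation greads := (reads gedge same).

(** Completeness of the saturation: overlining and composition make the graph respect the relations
    of I, so reading depends only on the value of a word. *)
Lemma greads_cong u v : word_val gen u = word_val gen v ->
  forall i j, greads u i j <-> greads v i j.
Proof.
move=> /gen_I_eq; apply: (reads_cong gedge_inverse) => {u v} u v.
have [c1 c2 _ _] := sat_closed W.
have r1 := reads1 gedge_inverse.
case=> [x|[x {}u] [y {}v]]; apply: (reads_rel_ge gedge_inverse) => i j.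
  move=> /r1 [[hx] h]; apply/r1; split; first by rewrite /named /= hx.
  exact: c1 h.
move=> /(reads_cat gedge_inverse) [k /r1 [[hu hu'] h] /r1 [[hv hv'] h']].
apply/r1; split.
  by rewrite /named /= map_cat /= map_cat /= hu hu' hv hv'.
apply: (c2 _ _ _ _ _ _ h h'); rewrite /lcomp !(negPf (name_neq_eps _)) /=.
by rewrite inE map_cat.
Qed.

Lemma greads_prefix p q : w = p ++ q -> greads p (size w) (size q).
Proof.
suff h r : w = r ++ p ++ q -> greads p (size (p ++ q)) (size q).
  by move=> e; have := h [::] e; rewrite -e.
elim: p r => [|l p ih] r e /=.
  apply/sat_linear/linear_vertex; rewrite size_map e size_cat; exact: leq_addl.
exists (size (p ++ q)); last by apply: (ih (rcons r l)); rewrite cat_rcons.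
have hl : named l.1 by move: w_named; rewrite e => /all_named_cat [_ []].
have := @linear_edge (name_word r) (l.2, name l.1) (name_word (p ++ q)).
move=> /=; rewrite -[_ :: name_word _]/(name_word (l :: p ++ q)).
rewrite -map_cat -[r ++ _]e => /sat_linear; rewrite size_map.
by case: l hl {e ih} => y []; split.
Qed.

Lemma greads_conn v i j : greads v i j -> conn (word_val gen v) (vtx i) (vtx j).
Proof.
elim: v i => [|l v ih] i /=; first exact: sat_conn.
move=> [k h /ih]; apply: conn_mul; case: l h => y [] [hy /sat_conn] /=;
  rewrite /lab_conn /letter_val lab_val_name//=; exact: conn_inv.
Qed.

Lemma mem_back l V i : i \in back (sat W) l V <-> exists2 j, j \in V &
  if l.1 then (j, (l.2, i)) \in sat W else (i, (l.2, j)) \in sat W.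
Proof.
split=> [/mapP[[p [a q]]]|[j jV h]].
  rewrite mem_filter /= => /andP[/andP[/eqP <- hV] hS] ->.
  by case: ifP hV => _ hV; [exists p | exists q].
apply/mapP; case: ifP h => hl h.
  by exists (j, (l.2, i)); rewrite ?mem_filter /= ?hl ?eqxx ?jV ?h.
by exists (i, (l.2, j)); rewrite ?mem_filter /= ?hl ?eqxx ?jV ?h.
Qed.

Lemma accepts_reads v : all_named v ->
  accepts W (name_word v) <-> greads v (size w) 0.
Proof.
rewrite /accepts size_map; move: (size w) => i.
elim: v i => [|[y b] v ih] i /=.
  move=> _; rewrite mem_back /=; split=> [[j]|h]; last by exists 0.
  by rewrite inE => /eqP ->.
move=> [hy /ih {}ih]; rewrite mem_back /=; split=> -[j].
  by move/ih=> hv h; exists j => //; case: b h; split.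
by move=> h /ih hv; exists j => //; case: b h => -[].
Qed.

(** The word u may be replaced by w w^-1 p, which runs along w, returns to the start and then
    follows p. *)
Lemma greads_of_prefix p q u i : w = p ++ q ->
  word_val gen u = s * s^-1 * word_val gen p ->
  greads u (size w) i <-> same (size q) i.
Proof.
move=> e hu; have gi := gedge_inverse.
have -> : greads u (size w) i <-> greads (w ++ word_inv w ++ p) (size w) i.
  by apply: greads_cong; rewrite !word_val_cat word_val_inv mulgA.
have hp := greads_prefix e; have hw := @greads_prefix w [::] (esym (cats0 w)).
split=> [/(reads_cat gi)[j h1 /(reads_cat gi)[k /(reads_word_inv gi) h2 h3]]|h].
  apply: (reads_det gi hp); apply: (reads_eqv gi (reads_codet gi h1 h2) h3).
  by case: (reads_refl gi h3).
apply/(reads_cat gi); exists 0 => //; apply/(reads_cat gi).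
exists (size w); first exact/(reads_word_inv gi).
by apply: (reads_eqv gi _ hp h); case: (reads_refl gi hp).
Qed.

(** A path from the start to the end says s s^-1 v = s. Conversely, if v is above s then w w^-1 v
    has the value of w and is read as w is; its part w w^-1 returns to the start. *)
Lemma accepts_le v : all_named v ->
  accepts W (name_word v) <-> inv_le s (word_val gen v).
Proof.
move=> hv; rewrite accepts_reads//; split=> [|h].
  by move/greads_conn; rewrite vtx_start vtx_end => -[h _]; apply: inv_leEr.
have gi := gedge_inverse.
have h0 : greads w (size w) 0 by apply: (@greads_prefix w [::]); rewrite cats0.
have : greads (w ++ word_inv w ++ v) (size w) 0.
  apply/(greads_cong _ _ _).2; last exact: h0.
  by rewrite !word_val_cat word_val_inv mulgA inv_leE.
move=> /(reads_cat gi)[j h1 /(reads_cat gi)[k /(reads_word_inv gi) h2 h3]].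
by apply: (reads_eqv gi (reads_codet gi h1 h2) h3); case: (reads_refl gi h3).
Qed.

Lemma sat_size i a j : (i, (a, j)) \in sat W -> i <= size w /\ j <= size w.
Proof.
apply: (sat_ind (P := fun i _ j => i <= size w /\ j <= size w)).
  by split=> //; move=> *; repeat match goal with H : _ /\ _ |- _ => case: H end.
by move=> f /linear_height []; rewrite size_map.
Qed.

Lemma sat_names i a j x :
  (i, (a, j)) \in sat W -> x \in lab_letters a -> n (d x) = x.
Proof.
move=> h; move: x; apply: (sat_ind (P := fun _ a _ =>
  forall x, x \in lab_letters a -> n (d x) = x)) h => [|f].
  split=> // i' j' k a' b c h1 h2 /lcomp_letters e x.
  by rewrite e mem_cat => /orP[/h1|/h2].
move=> /linear_height [_ _ h _] x /h /flattenP [_ /mapP[l hl ->]].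
elim: {h} (w) w_named hl => //= l' w' ih [h /ih {}ih].
rewrite inE => /orP[/eqP ->|/ih//]; exact: named_letters.
Qed.

Lemma sat_vertex i : i <= size w -> same i i.
Proof. by move=> h; apply/sat_linear/linear_vertex; rewrite size_map. Qed.

(** * Representatives of the vertices, and the isomorphism of graphs *)

Notation V := (vertices (sat W)).

Lemma mem_vertices i : i \in V -> i <= size w.
Proof.
by move=> /mem_undup_eps /mapP[[j [a k]] /sat_size [hj _] ->].
Qed.

Lemma vertices_repr i : i <= size w -> exists2 j, j \in V & same i j.
Proof.
move=> hi; have : i \in [seq f.1 | f <- sat W].
  by apply/mapP; exists (i, (eps, i)); first exact: sat_vertex.
rewrite /vertices; have gi := gedge_inverse.
suff h r : {subset r <= fun i => i <= size w} -> i \in r ->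
    exists2 j, j \in undup_eps (sat W) r & same i j.
  by apply: h => j /mapP[[k [a l]] /sat_size [hk _] ->].
elim: r i {hi} => //= j r ih i hr; rewrite inE.
have hr' : {subset r <= fun i => i <= size w}.
  by move=> k hk; apply: hr; rewrite inE hk orbT.
case: (@hasP _ (fun k => (j, (eps, k)) \in sat W) r) => [[k hk ejk]|_];
  move=> /orP[/eqP ->|/(ih _ hr') [l hl eil]].
- by have [l hl ekl] := ih _ hr' hk; exists l => //; apply: (eqv_trans gi ejk ekl).
- by exists l.
- by exists j; rewrite ?mem_head//; apply/sat_vertex/hr/mem_head.
- by exists l; rewrite // inE hl orbT.
Qed.

Lemma vertices_same i j : i \in V -> j \in V -> same i j -> i = j.
Proof.
rewrite /vertices; have sym := eqv_sym gedge_inverse.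
elim: [seq f.1 | f <- sat W] => //= k r ih; case: ifP => // /hasPn hk.
rewrite !inE => /orP[/eqP ->|hi] /orP[/eqP ->|hj] // e; last exact: ih.
- by have := hk _ (mem_undup_eps hj); rewrite (_ : _ \in _ = true).
- by have := hk _ (mem_undup_eps hi); rewrite (_ : _ \in _ = true)//; apply: sym.
Qed.

Lemma vertices_uniq : uniq V.
Proof.
rewrite /vertices; suff h r : {subset r <= fun i => i <= size w} ->
    uniq (undup_eps (sat W) r).
  by apply: h => j /mapP[[k [a l]] /sat_size [hk _] ->].
elim: r => //= k r ih hr.
have hr' : {subset r <= fun i => i <= size w}.
  by move=> j hj; apply: hr; rewrite inE hj orbT.
case: ifP => [_|/hasPn hk]; first exact: ih.
rewrite /= ih// andbT; apply/negP => hin.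
have {}hin := mem_undup_eps hin.
by have := hk _ hin; rewrite sat_vertex//; apply/hr'.
Qed.

Definition sch_finite_graph : finite_graph (letter (gens X)) :=
  let G := sch_graph W in
  FiniteGraph G.1 [seq (e.1, (unname e.2.1.2, e.2.1.1), e.2.2) | e <- G.2].

Lemma mem_sch_graph e : e \in (sch_graph W).2 <->
  exists i a j, [/\ (i, (a, j)) \in sat W, i \in V, j \in V, a != eps &
    e = (index i V, ((false, a), index j V)) \/
    e = (index j V, ((true, a), index i V))].
Proof.
split=> [/flattenP[_ /mapP[[i [a j]] hf ->]] /=|[i [a [j [hf iV jV ha he]]]]].
  case: ifP => // /and3P[iV jV ha]; rewrite !inE => he; exists i, a, j; split=> //.
  by case/orP: he => /eqP ->; [left|right].
apply/flattenP; eexists; first by apply/mapP; exists (i, (a, j)).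
by rewrite /= iV jV ha /= !inE; case: he => ->; rewrite eqxx ?orbT.
Qed.

Lemma vtx_prefix i : i <= size w ->
  exists p q, [/\ w = p ++ q, size q = i & greads p (size w) i].
Proof.
move=> hi; exists (take (size w - i) w), (drop (size w - i) w).
have hq : size (drop (size w - i) w) = i by rewrite size_drop subKn.
by split; rewrite ?cat_take_drop// -{2}hq; apply/greads_prefix; rewrite cat_take_drop.
Qed.

Lemma vtx_vertex i : i <= size w -> sch_vertices s (vtx i).
Proof.
move=> /vtx_prefix [p [q [_ _ /greads_conn/conn_R]]]; rewrite vtx_start => h.
by rewrite /sch_vertices /= h invgM invgK !mulgA mulgVg.
Qed.

(** With p the prefix at i, the word w w^-1 p l has the value at vertex j, so it is read from the
    start to j; determinism shows that its last letter starts at i. *)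
Lemma vtx_edge i l j : i <= size w -> j <= size w ->
  vtx j = vtx i * letter_val gen l -> edge gedge i l j.
Proof.
move=> hi hj e; have gi := gedge_inverse.
have [p [q [ep hq rp]]] := vtx_prefix hi; have [p' [q' [ep' hq' rp']]] := vtx_prefix hj.
have hu : word_val gen (w ++ word_inv w ++ rcons p l) = s * s^-1 * word_val gen p'.
  rewrite -(vtx_cat ep') hq' e -hq (vtx_cat ep) -cats1 !word_val_cat word_val_inv /=.
  by rewrite mulg1 !mulgA.
have : greads (w ++ word_inv w ++ rcons p l) (size w) j.
  by apply/(greads_of_prefix j ep' hu); rewrite hq'; apply: sat_vertex.
move=> /(reads_cat gi)[k h1 /(reads_cat gi)[m /(reads_word_inv gi) h2]].
rewrite -cats1 => /(reads_cat gi)[r h3 /(reads1 gi) h4].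
have h5 := reads_eqv gi (reads_codet gi h1 h2) h3 (reads_refl gi h3).2.
apply: (edge_eqv gi (reads_det gi rp h5) h4); exact: (edge_refl gi h4).2.
Qed.

Lemma vtx_inj i j : i <= size w -> j <= size w -> vtx i = vtx j -> same i j.
Proof.
move=> hi hj; have gi := gedge_inverse.
have [p [q [ep hq rp]]] := vtx_prefix hi; have [p' [q' [ep' hq' rp']]] := vtx_prefix hj.
rewrite -hq (vtx_cat ep) -hq' (vtx_cat ep') => e.
have hu : word_val gen (w ++ word_inv w ++ p') = s * s^-1 * word_val gen p.
  by rewrite e !word_val_cat word_val_inv mulgA.
apply/(greads_of_prefix _ ep hu).
apply/(greads_of_prefix (q := q') _ ep'); last by apply: sat_vertex; rewrite hq'.
by rewrite !word_val_cat word_val_inv mulgA.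
Qed.

(** If v represents t, then v v^-1 has the value of w w^-1 and is read at the start; hence so is v,
    and its path ends at the required vertex. *)
Lemma vtx_surj t : sch_vertices s t -> exists2 i, i <= size w & t = vtx i.
Proof.
elim/inv_class_ind: t => v; rewrite -inv_word_val => /= ht.
have h0 : greads w (size w) 0 by apply: (@greads_prefix w [::]); rewrite cats0.
have gi := gedge_inverse.
have : greads (w ++ word_inv w) (size w) (size w).
  by apply/(reads_loop gi); split; [apply: sat_vertex | exists 0].
have e : word_val gen (w ++ word_inv w) = word_val gen (v ++ word_inv v).
  by rewrite !word_val_cat !word_val_inv.
move=> /(greads_cong e) /(reads_loop gi) [_ [i hi]].
exists i; first by have [_ /sat_size []] := reads_refl gi hi.
have [-> _] := greads_conn hi; rewrite vtx_start -ht; exact/esym/mulgVg.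
Qed.

Lemma In_mem (T : eqType) (x : T) r : List.In x r <-> x \in r.
Proof.
elim: r => //= y r ih; rewrite inE; split=> [[->|/ih ->]|/orP[/eqP ->|/ih]];
  by rewrite ?eqxx ?orbT; auto.
Qed.

Theorem sch_finite_graph_iso :
  graph_iso sch_finite_graph (sch_vertices s) (sch_edges gen s).
Proof.
have hV k : (k < size V)%N -> nth 0 V k \in V by apply: mem_nth.
have hv k : (k < size V)%N -> nth 0 V k <= size w by move/hV/mem_vertices.
exists (fun k => vtx (nth 0 V k)).
  split.
  - by move=> k /= /hv /vtx_vertex.
  - move=> k l; rewrite !inE /= => hk hl.
    move/(vtx_inj (hv _ hk) (hv _ hl))/(vertices_same (hV _ hk) (hV _ hl)).
    by move/eqP; rewrite nth_uniq ?vertices_uniq// => /eqP.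
  - move=> t /vtx_surj [i /vertices_repr [j hj eij] ->].
    exists (index j V) => /=; first by rewrite index_mem.
    by rewrite nth_index//; have [-> _] := sat_conn eij; rewrite mulg1.
move=> k l k'; split.
  move=> /List.in_map_iff [e [he /In_mem /mem_sch_graph [i [a [j []]]]]].
  move=> hS iV jV ha; have c := sat_conn hS; move: c he.
  rewrite /lab_conn lab_valE// => c he hh.
  have iW := mem_vertices iV; have jW := mem_vertices jV.
  case: hh he c => -> [<- <- <-] [c1 c2] /=; rewrite !index_mem; split=> //;
    rewrite !nth_index//; split=> //; exact: vtx_vertex.
move=> [/= hk hk' [_ _ /(vtx_edge (hv _ hk) (hv _ hk')) h]].
apply/List.in_map_iff; case: l h => y [] [/= hy h].
  exists (k, ((true, name y), k')); split; first by rewrite /= hy.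
  apply/In_mem/mem_sch_graph; exists (nth 0 V k'), (name y), (nth 0 V k).
  rewrite !hV// name_neq_eps; split=> //; right.
  by rewrite !index_uniq// vertices_uniq.
exists (k, ((false, name y), k')); split; first by rewrite /= hy.
apply/In_mem/mem_sch_graph; exists (nth 0 V k), (name y), (nth 0 V k').
rewrite !hV// name_neq_eps; split=> //; left.
by rewrite !index_uniq// vertices_uniq.
Qed.

(** Makes the computed labels agree with the codes of the generators that they stand for. *)
Lemma sch_graph_names i b a j :
  (i, ((b, a), j)) \in (sch_graph W).2 -> name (unname a) = a.
Proof.
move=> /mem_sch_graph [i' [a' [j' [h _ _ ha e]]]].
have -> : a = a' by case: e => [] [].
by apply: unnameK => // x; apply: sat_names h.
Qed.

End Graph.
End Names.

(** * The free F-birestriction monoid *)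

(** Projections are sigma-related to 1, and a maximum stays in its sigma-class. *)
Fixpoint term_trace (X : Type) (t : term X) : seq X :=
  match t with
  | TVar x => [:: x]
  | TMul a b => term_trace a ++ term_trace b
  | TMax a => term_trace a
  | TOne | TStar _ | TPlus _ => [::]
  end.

(** The empty trace gives the empty word, as 1 is the maximum of its own sigma-class. *)
Definition over_word (X : Type) (u : seq X) : word (gens X) :=
  if u is x :: u' then Defs.over (x, u') else [::].

Fixpoint term_word (X : Type) (t : term X) : word (gens X) :=
  match t with
  | TVar x => plain x
  | TOne => [::]
  | TMul a b => term_word a ++ term_word b
  | TStar a => word_inv (term_word a) ++ term_word a
  | TPlus a => term_word a ++ word_inv (term_word a)
  | TMax a => over_word (term_trace a)
  end.

(* The F-birestriction monoid of the pairs (a, u) with a below the overlined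
   word u: two elements are sigma-related iff they have the same u. *)
Section BelowOver.
Context (X : Type).
Notation I := (monoid_I X).

Definition below_over : Type :=
  {p : I * seq X | inv_le p.1 (over_val p.2)}.

HB.instance Definition _ := gen_eqMixin below_over.
HB.instance Definition _ := gen_choiceMixin below_over.

Implicit Types p q : below_over.

Lemma below_over_eq p q : (sval p).1 = (sval q).1 -> (sval p).2 = (sval q).2 -> p = q.
Proof.
case: p q => [[a u] ha] [[b v] hb] /= ea eu; apply: eq_exist => /=.
by rewrite ea eu.
Qed.

Definition bo_one : below_over := exist _ (1, [::]) (inv_le_refl 1).

Lemma bo_mul_subproof p q :
  inv_le ((sval p).1 * (sval q).1) (over_val ((sval p).2 ++ (sval q).2)).
Proof. exact: inv_le_trans (inv_le_mul (svalP p) (svalP q)) (over_val_mul _ _). Qed.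

Definition bo_mul p q : below_over :=
  exist _ ((sval p).1 * (sval q).1, (sval p).2 ++ (sval q).2) (bo_mul_subproof p q).

Definition bo_star p : below_over :=
  exist _ ((sval p).1^-1 * (sval p).1, [::]) (inv_le1 (sval p).1).

Definition bo_plus p : below_over :=
  exist _ ((sval p).1 * (sval p).1^-1, [::]) (inv_leV1 (sval p).1).

Definition bo_max p : below_over :=
  exist _ (over_val (sval p).2, (sval p).2) (inv_le_refl _).

Lemma bo_mulA : associative bo_mul.
Proof. by move=> p q r; apply: below_over_eq => /=; rewrite ?mulgA ?catA. Qed.

Lemma bo_1mul : left_id bo_one bo_mul.
Proof. by move=> p; apply: below_over_eq => /=; rewrite ?mul1g. Qed.

Lemma bo_mul1 : right_id bo_one bo_mul.
Proof. by move=> p; apply: below_over_eq => /=; rewrite ?mulg1 ?cats0. Qed.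

HB.instance Definition _ := isMonoid.Build below_over bo_mulA bo_1mul bo_mul1.

Lemma bo_mul_star p : p * bo_star p = p.
Proof. by apply: below_over_eq => /=; rewrite ?invm_regular ?cats0. Qed.

Lemma bo_starC p q : bo_star p * bo_star q = bo_star q * bo_star p.
Proof. by apply: below_over_eq => //=; rewrite invm_commV. Qed.

Lemma bo_star_mulstar p q : bo_star (p * bo_star q) = bo_star p * bo_star q.
Proof.
apply: below_over_eq => //=; move: (sval p).1 (sval q).1 => a b.
rewrite !invgM invgK.
transitivity (b^-1 * b * (a^-1 * a) * (b^-1 * b)); first by rewrite !mulgA.
by rewrite invm_commV -mulgA -[b^-1 * b * _]mulgA invm_regular.
Qed.

Lemma bo_starA p q : bo_star p * q = q * bo_star (p * q).
Proof.
apply: below_over_eq => /=; rewrite ?cats0//; move: (sval p).1 (sval q).1 => a b.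
rewrite invgM.
transitivity (b * b^-1 * (a^-1 * a) * b); last by rewrite !mulgA.
by rewrite invm_comm -!mulgA invm_regular.
Qed.

Lemma bo_plus_mul p : bo_plus p * p = p.
Proof. by apply: below_over_eq => //=; rewrite mulgVg. Qed.

Lemma bo_plusC p q : bo_plus p * bo_plus q = bo_plus q * bo_plus p.
Proof. by apply: below_over_eq => //=; rewrite mulgVC. Qed.

Lemma bo_plus_plusmul p q : bo_plus (bo_plus p * q) = bo_plus p * bo_plus q.
Proof.
apply: below_over_eq => //=; move: (sval p).1 (sval q).1 => a b.
rewrite !invgM invgK.
transitivity (a * a^-1 * (b * b^-1 * (a * a^-1))); first by rewrite !mulgA.
by rewrite (mulgVC b) !mulgA mulgVg.
Qed.

Lemma bo_plusA p q : p * bo_plus q = bo_plus (p * q) * p.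
Proof.
apply: below_over_eq => /=; rewrite ?cats0//; move: (sval p).1 (sval q).1 => a b.
rewrite invgM; transitivity (a * (b * b^-1 * (a^-1 * a))); last by rewrite !mulgA.
by rewrite invm_comm [in RHS]mulgA invm_regular.
Qed.

Lemma bo_star_plus p : bo_star (bo_plus p) = bo_plus p.
Proof. by apply: below_over_eq => //=; rewrite invgM invgK mulgA mulgVg. Qed.

Lemma bo_plus_star p : bo_plus (bo_star p) = bo_star p.
Proof. by apply: below_over_eq => //=; rewrite invgM invgK -mulgA invm_regular. Qed.

HB.instance Definition _ := Monoid_isBirestriction.Build below_over
  bo_mul_star bo_starC bo_star_mulstar bo_starA bo_plus_mul bo_plusC
  bo_plus_plusmul bo_plusA bo_star_plus bo_plus_star.

(** Projections have an empty second component, so sigma-related pairs share u, and the overlined u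
    bounds all their first components. *)
Lemma bo_maxP p : max_of_sigma_class p (bo_max p).
Proof.
split.
  exists (star p); first by exists p.
  apply: below_over_eq => //=; rewrite invm_regular; exact: (svalP p).
move=> q [_ [r ->]] /(congr1 (fun p => (sval p).2)) /=; rewrite !cats0 => e.
exists (star (plus q)); first by exists (plus q).
rewrite star_plus; apply: below_over_eq => //=.
by rewrite e (inv_leE (svalP q)).
Qed.

HB.instance Definition _ := Birestriction_isF.Build below_over bo_maxP.

Definition bo_gen (x : X) : below_over :=
  exist _ (gen_I (inl x), [:: x]) (letter_le x).

Lemma word_val_over_word u : word_val (@gen_I X) (over_word u) = over_val u.
Proof. by case: u => [|x u] //=; rewrite mulg1. Qed.

(** Evaluation here reads off the word in I and the trace, so both are invariants of terms equal in
    [FFBR X]. *)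
Lemma bo_term_val t :
  sval (term_val bo_gen t) = (word_val (@gen_I X) (term_word t), term_trace t).
Proof.
elim: t => /= [x||a iha b ihb|a ih|a ih|a ih]; rewrite ?mulg1// ?word_val_cat.
- by rewrite iha ihb.
- by rewrite ih word_val_inv.
- by rewrite ih word_val_inv.
- by rewrite ih word_val_over_word.
Qed.

End BelowOver.

(** * Birestriction monoids and their Munn representation *)

Section Birestriction.
Context {S : birestrictionMonoidType}.
Implicit Types a b e s t : S.

Lemma starK a : star (star a) = star a.
Proof. by rewrite -{1}(plus_star a) star_plus plus_star. Qed.

Lemma plus_mulr a b : plus (a * plus b) = plus (a * b).
Proof.
by rewrite plusA plus_plusmul (plusC (a * b)) -plus_plusmul mulgA plus_mul.
Qed.

Lemma star_mull a b : star (star a * b) = star (a * b).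
Proof.
by rewrite starA star_mulstar (starC b) -star_mulstar -mulgA mul_star.
Qed.

Lemma plus1 : plus (1 : S) = 1.
Proof. by have := plus_mul (1 : S); rewrite mulg1. Qed.

Lemma sigma_sym s t : sigma s t -> sigma t s.
Proof. by move=> [e he h]; exists e. Qed.

Lemma sigma_trans r s t : sigma r s -> sigma s t -> sigma r t.
Proof.
move=> [_ [a ->] h1] [_ [b ->] h2]; exists (star a * star b).
  by exists (star a * star b); rewrite star_mulstar starK.
by rewrite mulgA h1 -mulgA starC mulgA h2 -mulgA starC.
Qed.

Lemma sigma_mul a a' b b' : sigma a a' -> sigma b b' -> sigma (a * b) (a' * b').
Proof.
move=> [_ [r ->] h1] [_ [t ->] h2]; apply: (@sigma_trans _ (a * b')).
  exists (star t); first by exists t.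
  by rewrite -!mulgA h2.
exists (star (r * b')); first by exists (r * b').
by rewrite -!mulgA -starA !mulgA h1.
Qed.

Lemma sigma_star a : sigma (star a) 1.
Proof. by exists (star a); [exists a | rewrite mul1g -star_mulstar mul_star]. Qed.

Lemma sigma_plus a : sigma (plus a) 1.
Proof. by rewrite -star_plus; apply: sigma_star. Qed.

Lemma natural_le_antisym s t : natural_le s t -> natural_le t s -> s = t.
Proof.
move=> /natural_le_plus h1 /natural_le_plus h2.
transitivity (plus s * (plus t * s)); first by rewrite -h2 -h1.
by rewrite mulgA plusC -mulgA plus_mul -h2.
Qed.

(* The Munn representation: [munn a] is the isomorphism e |-> (ea)^* from the
   projections below a^+ onto those below a^*. *)
Definition munn a e e' : Prop := [/\ e = star e, e * plus a = e & e' = star (e * a)].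

Lemma proj_plus e : e = star e -> plus e = e.
Proof. by move=> h; rewrite h plus_star. Qed.

Lemma proj_mulA a e : e = star e -> e * a = a * star (e * a).
Proof. by move=> h; rewrite {1}h starA. Qed.

Lemma plus_projl a e : e = star e -> plus (e * a) = e * plus a.
Proof. by move=> /proj_plus h; rewrite -{1}h plus_plusmul h. Qed.

Lemma munn_codom a e e' : munn a e e' ->
  [/\ e' = star e', e' * star a = e' & e = plus (a * e')].
Proof.
move=> [h1 h2 ->]; rewrite starK -star_mulstar -mulgA mul_star; split=> //.
by rewrite -proj_mulA// plus_projl.
Qed.

Lemma munn_comp a b e e' :
  munn (a * b) e e' <-> exists2 r, munn a e r & munn b r e'.
Proof.
split=> [[h1 h2 ->]|[r ha hb]].
  have ea : e * plus a = e.
    by rewrite -h2 -mulgA (plusC (a * b)) -plus_plusmul mulgA plus_mul.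
  exists (star (e * a)); split; rewrite ?starK ?star_mull ?mulgA//.
  by rewrite -(star_plus b) -star_mulstar star_plus -mulgA plusA mulgA h2.
have [r1 r2 r3] := munn_codom ha; move: ha hb => [h1 h2 h3] [_ h4 ->].
split=> //; last by rewrite h3 star_mull mulgA.
rewrite -plus_projl// mulgA (proj_mulA a h1) -h3 -mulgA -plus_mulr (plus_projl b r1) h4.
by rewrite -r3.
Qed.

Lemma munn_det a e e' e'' : munn a e e' -> munn a e e'' -> e' = e''.
Proof. by move=> [_ _ ->] [_ _ ->]. Qed.

Lemma munn_inj a e e' r : munn a e r -> munn a e' r -> e = e'.
Proof. by move=> /munn_codom [_ _ ->] /munn_codom [_ _ ->]. Qed.

Lemma munn_proj a e e' : munn (star a) e e' <-> [/\ e = star e, e * star a = e & e' = e].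
Proof.
rewrite /munn plus_star; split=> -[h1 h2 ->]; split=> //; by rewrite h2 -h1.
Qed.

(** The star becomes the identity on the range of [munn a], which is a^-1 a for partial
    injections. *)
Lemma munn_star a e e' :
  munn (star a) e e' <-> exists2 r, munn a r e & munn a r e'.
Proof.
rewrite munn_proj; split=> [[h1 h2 ->]|[r h h']].
  (* The preimage of e under the Munn isomorphism is (ae)^+. *)
  suff h : munn a (plus (a * e)) e by exists (plus (a * e)).
  split; first by rewrite star_plus.
    by rewrite plusC -plus_plusmul mulgA plus_mul.
  rewrite -plusA (proj_plus h1) h1 star_mulstar -h1.
  by rewrite {2}h1 starC -h1 h2.
have [h1 h2 _] := munn_codom h; split=> //; exact: munn_det h' h.
Qed.

Lemma munn_plus a e e' :
  munn (plus a) e e' <-> exists2 r, munn a e r & munn a e' r.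
Proof.
rewrite -star_plus munn_proj star_plus; split=> [[h1 h2 ->]|[r h h']].
  by exists (star (e * a)); split.
by have [h1 h2 _] := h; split=> //; apply: munn_inj h' h.
Qed.

Lemma munn_le a b e e' : natural_le a b -> munn a e e' -> munn b e e'.
Proof.
move=> /natural_le_plus h [h1 h2 ->].
have hp : plus a = plus a * plus b by rewrite -plus_plusmul -h.
split=> //; first by rewrite -h2 -mulgA -hp.
by rewrite {1}h mulgA h2.
Qed.

Lemma munn1 e e' : munn 1 e e' <-> e = star e /\ e = e'.
Proof. by rewrite /munn plus1 !mulg1; split=> [[h1 _ ->]|[h1 <-]]. Qed.

(** The largest projection in the domain of [munn a] is a^+. *)
Lemma munn_plus_eq a b : (forall e e', munn a e e' <-> munn b e e') ->
  plus a = plus b.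
Proof.
have h c r : (forall e e', munn c e e' -> munn r e e') -> plus c * plus r = plus c.
  move=> e; suff /e [_ ->] : munn c (plus c) (star c) by [].
  by split; rewrite ?star_plus ?plus_mul// -plus_plusmul plus_mul.
move=> e; have hab := h a b (fun x y => (e x y).1).
by rewrite -hab plusC (h b a (fun x y => (e x y).2)).
Qed.

End Birestriction.

(** * The action of I on the projections of an F-birestriction monoid *)

Section MunnGraph.
Context {X : Type} {S : fBirestrictionMonoidType} (f : X -> S).

Lemma fmax_sigma (s t : S) : sigma s t -> fmax s = fmax t.
Proof.
suff h (a b : S) : sigma a b -> natural_le (fmax a) (fmax b).
  by move=> st; apply: natural_le_antisym; apply: h => //; apply: sigma_sym.
move=> ab; have [_] := fmaxP b; apply; apply: (sigma_trans (sigma_sym ab)).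
by case: (fmaxP a).
Qed.

Lemma fmax1 : fmax (1 : S) = 1.
Proof. by have := natural_le_plus (fmax_ge (1 : S)); rewrite plus1 mul1g. Qed.

Definition trace_val (u : seq X) : S := foldr (fun x s => f x * s) 1 u.

Lemma trace_val_cat u v : trace_val (u ++ v) = trace_val u * trace_val v.
Proof. by elim: u => [|x u /= ->]; rewrite ?mul1g ?mulgA. Qed.

Lemma term_val_sigma t : sigma (term_val f t) (trace_val (term_trace t)).
Proof.
elim: t => /= [x||a iha b ihb|a _|a _|a ih]; rewrite ?mulg1.
- exact: sigma_refl.
- exact: sigma_refl.
- by rewrite trace_val_cat; apply: sigma_mul.
- exact: sigma_star.
- exact: sigma_plus.
- by apply: sigma_trans ih; apply: sigma_sym; case: (fmaxP (term_val f a)).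
Qed.

Definition gens_val (y : gens X) : S :=
  match y with inl x => f x | inr u => fmax (trace_val (fs_seq u)) end.

Definition munn_edge (e : S) (y : gens X) (e' : S) : Prop := munn (gens_val y) e e'.
Definition proj_eq (e e' : S) : Prop := e = star e /\ e = e'.

Lemma munn_graph : inverse_graph munn_edge proj_eq.
Proof.
split; rewrite /proj_eq.
- by move=> p q [h <-].
- by move=> p q r [h <-] [_ <-].
- by move=> p p' y q q' [_ ->] h [_ <-].
- move=> p y q q' h h'; have [hq _ _] := munn_codom h.
  by split=> //; apply: munn_det h h'.
- by move=> p p' y q h h'; split; [case: h | apply: munn_inj h h'].
Qed.

Notation mreads := (reads munn_edge proj_eq).

(** An element is below its maximum, and the product of the maxima of two sigma-classes lies in the
    product class, hence below its maximum. *)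
Lemma mreads_cong u v : inv_cong (@rel_I X) u v ->
  forall e e', mreads u e e' <-> mreads v e e'.
Proof.
have G := munn_graph; apply: (reads_cong G) => {u v} u v.
case=> [x|[x {}u] [y {}v]]; apply: (reads_rel_ge G) => e e'.
  move=> /(reads1 G) h; apply/(reads1 G); apply: munn_le h => /=.
  by rewrite mulg1; apply: fmax_ge.
move=> /(reads_cat G)[r /(reads1 G) h1 /(reads1 G) h2]; apply/(reads1 G).
have /munn_le : natural_le (gens_val (inr (x, u)) * gens_val (inr (y, v)))
    (gens_val (inr (fs_cat (x, u) (y, v)))).
  have [_ mx] := fmaxP (trace_val (fs_seq (fs_cat (x, u) (y, v)))); apply: mx.
  rewrite /fs_cat /fs_seq /= trace_val_cat mulgA.
  by apply: sigma_mul;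
    [case: (fmaxP (f x * trace_val u)) | case: (fmaxP (f y * trace_val v))].
by apply; apply/munn_comp; exists r.
Qed.

(** Star and plus are path forms of a^-1 a and a a^-1; a maximum depends only on the trace. *)
Lemma mreads_term t e e' : mreads (term_word t) e e' <-> munn (term_val f t) e e'.
Proof.
have G := munn_graph; elim: t e e' => [x||a iha b ihb|a ih|a ih|a ih] e e'.
- by rewrite [term_word _]/(plain x) (reads1 G).
- by rewrite /= munn1.
- rewrite /= (reads_cat G) munn_comp; split=> -[r h h']; exists r;
    by [apply/iha | apply/ihb].
- rewrite /= (reads_cat G) munn_star; split=> -[r h h']; exists r;
    by [apply/ih/(reads_word_inv G) | apply/(reads_word_inv G)/ih | apply/ih].
- rewrite /= (reads_cat G) munn_plus; split=> -[r h h']; exists r;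
    by [apply/ih/(reads_word_inv G) | apply/(reads_word_inv G)/ih | apply/ih].
- rewrite /= (fmax_sigma (term_val_sigma a)); case: (term_trace a) => [|x u].
    by rewrite /= fmax1 munn1.
  by rewrite [over_word _]/(Defs.over (x, u)) (reads1 G).
Qed.

Lemma term_val_eq s t : term_trace s = term_trace t ->
  inv_cong (@rel_I X) (term_word s) (term_word t) -> term_val f s = term_val f t.
Proof.
move=> htr hc.
rewrite (natural_le_plus (fmax_ge (term_val f s))).
rewrite [RHS](natural_le_plus (fmax_ge (term_val f t))).
rewrite (fmax_sigma (term_val_sigma s)) (fmax_sigma (term_val_sigma t)) htr.
congr (_ * _); apply: munn_plus_eq => e e'.
by rewrite -!mreads_term; apply: mreads_cong.
Qed.

End MunnGraph.

Theorem ffbr_term_eq (X : Type) (s t : term X) :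
  term_val (@ffbr_gen X) s = term_val (@ffbr_gen X) t <->
  term_trace s = term_trace t /\
  word_val (@gen_I X) (term_word s) = word_val (@gen_I X) (term_word t).
Proof.
rewrite !ffbr_term_val ffbr_classP gen_I_eq; split=> [h|[h1 h2] S f].
  by have := congr1 sval (h _ (@bo_gen X)); rewrite !bo_term_val => -[/gen_I_eq].
exact: term_val_eq.
Qed.

(** * Programs *)

Definition lword_inv (w : lword) : lword := rev [seq (~~ l.1, l.2) | l <- w].

Definition term_data : Type := (lword * seq data)%type.

(* [r] is the list of the values of the payload b of a term and of its two
   children, as b is either a term or a pair of terms. *)
Definition read_node (a b : data) (r : term_data * (term_data * term_data)) :
    term_data :=
  if a == enc_nat 0 then ([:: (false, inl b)], [:: b]) else
  if a == enc_nat 1 then ([::], [::]) else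
  if a == enc_nat 2 then (r.2.1.1 ++ r.2.2.1, r.2.1.2 ++ r.2.2.2) else
  if a == enc_nat 3 then (lword_inv r.1.1 ++ r.1.1, [::]) else
  if a == enc_nat 4 then (r.1.1 ++ lword_inv r.1.1, [::]) else
  (if nilp r.1.2 then [::] else [:: (false, inr r.1.2)], r.1.2).

(** The values of both children are returned as well, since the factors of a product lie two levels
    below its node. *)
Fixpoint read_tree (d : data) : term_data * (term_data * term_data) :=
  match d with
  | Leaf => (([::], [::]), (([::], [::]), ([::], [::])))
  | Node a b => let r := read_tree b in (read_node a b r, ((read_tree a).1, r.1))
  end.

Lemma c_read_tree : computable read_tree.
Proof.
apply: (@c_datarec _ _ read_tree _ (fun a b r r' => (read_node a b r', (r.1, r'.1)))) => //.
by rewrite /read_node /lword_inv; computability.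
Qed.

Lemma In_word_letters_cat (X : Type) (x : X) u v :
  List.In x (word_letters (u ++ v)) <->
  List.In x (word_letters u) \/ List.In x (word_letters v).
Proof. by rewrite /word_letters map_cat flatten_cat List.in_app_iff. Qed.

Lemma In_word_letters_inv (X : Type) (x : X) u :
  List.In x (word_letters (word_inv u)) <-> List.In x (word_letters u).
Proof.
elim: u => //= l u ih; rewrite /word_inv /= rev_cons -cats1 In_word_letters_cat ih.
rewrite -[l :: u]/([:: l] ++ u) In_word_letters_cat.
by rewrite [word_letters [:: letter_inv l]]/(word_letters [:: l]); tauto.
Qed.

Lemma term_trace_letters (X : Type) (x : X) t :
  List.In x (term_trace t) -> List.In x (term_letters t).
Proof. by elim: t => //= a iha b ihb; rewrite !List.in_app_iff; tauto. Qed.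

Lemma term_word_letters (X : Type) (x : X) t :
  List.In x (word_letters (term_word t)) -> List.In x (term_letters t).
Proof.
elim: t => //= [a iha b ihb|a ih|a ih|a _].
- by rewrite In_word_letters_cat List.in_app_iff; tauto.
- by rewrite In_word_letters_cat In_word_letters_inv; tauto.
- by rewrite In_word_letters_cat In_word_letters_inv; tauto.
- move=> h; apply: term_trace_letters; case: (term_trace a) h => //= y u.
  by rewrite /word_letters /= cats0.
Qed.

(** * Codes of words and terms through a naming of the letters *)

Section Encodings.
Context {X : Type} (c : X -> nat).
Definition cname (x : X) : data := enc_nat (c x).

Lemma name_word_cat u v :
  name_word cname (u ++ v) = name_word cname u ++ name_word cname v.
Proof. exact: map_cat. Qed.

Lemma name_word_inv u : name_word cname (word_inv u) = lword_inv (name_word cname u).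
Proof. by rewrite /name_word /word_inv /lword_inv map_rev -!map_comp. Qed.

Lemma read_tree_term t : (read_tree (enc_term c t)).1 =
  (name_word cname (term_word t), map cname (term_trace t)).
Proof.
elim: t => [x||a iha b ihb|a ih|a ih|a ih] //=.
- by rewrite /read_node /= iha ihb name_word_cat map_cat.
- by rewrite /read_node /= ih name_word_cat name_word_inv.
- by rewrite /read_node /= ih name_word_cat name_word_inv.
- by rewrite /read_node /= ih; case: (term_trace a).
Qed.

Lemma enc_seq_map (A B : Type) (e : B -> data) (g : A -> B) (r : seq A) :
  enc_seq e (map g r) = enc_seq (fun x => e (g x)) r.
Proof. by elim: r => //= x r ->. Qed.

Lemma enc_name y : enc (name cname y) = enc_gen c y.
Proof. by case: y => //= u; rewrite !enc_seq_map. Qed.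

Lemma enc_name_word w : enc (name_word cname w) = enc_word c w.
Proof.
by elim: w => //= l w <-; congr (Node (Node _ _) _); apply: enc_name.
Qed.

Lemma separates_unname s : inhabited X -> separates c s ->
  exists d : data -> X, forall x, List.In x s -> d (cname x) = x.
Proof.
(* Trees that name no letter of s are sent to the default letter x0. *)
move=> [x0] hs; exists (fun a =>
  if pselect (exists2 x, List.In x s & cname x = a) is left h then s2val (cid2 h)
  else x0).
move=> x hx; case: pselect => [h|[]]; last by exists x.
case: cid2 => y hy e /=; have {}e : c y = c x by apply: (@enc_inj nat).
by apply: hs => //; apply/mem_set.
Qed.

Lemma all_named_letters d w :
  (forall x, List.In x (word_letters w) -> d (cname x) = x) -> all_named cname d w.
Proof.
elim: w => //= l w ih; rewrite -[l :: w]/([:: l] ++ w) => h.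
split; last by apply: ih => x hx; apply/h/In_word_letters_cat; right.
have {ih}h x : List.In x (word_letters [:: l]) -> d (cname x) = x.
  by move=> hx; apply/h/In_word_letters_cat; left.
case: l h => -[x|[x u]] b; rewrite /word_letters /= ?cats0 /named /= => h.
  by rewrite h//; left.
rewrite h; last by left.
have {}h y : List.In y u -> d (cname y) = y by move=> hy; apply: h; right.
congr (inr (_, _)); elim: u h => //= y u ih h.
by rewrite h ?ih//; [move=> z hz; apply: h; right | left].
Qed.

End Encodings.

Lemma accepts_eq (X : Type) (n : X -> data) d u v :
  all_named n d u -> all_named n d v ->
  (accepts (name_word n u) (name_word n v) &&
   accepts (name_word n v) (name_word n u)) = true <->
  word_val (@gen_I X) u = word_val (@gen_I X) v.
Proof.
move=> hu hv; have h1 := accepts_le hu hv; have h2 := accepts_le hv hu.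
split=> [/andP[/h1 l1 /h2 l2]|e]; first exact: inv_le_antisym.
apply/andP; split; [apply/h1 | apply/h2]; rewrite e; exact: inv_le_refl.
Qed.

Lemma runs_accepts2 :
  runs (fun q : lword * lword => accepts q.1 q.2 && accepts q.2 q.1).
Proof.
apply: (runs_comp (g := fun q : bool * bool => q.1 && q.2)
  (f := fun q : lword * lword => (accepts q.1 q.2, accepts q.2 q.1))).
  by apply: computable_runs; computability.
apply: runs_pair; first exact: runs_accepts.
apply: (runs_comp (f := fun q : lword * lword => (q.2, q.1)) runs_accepts).
by apply: computable_runs; computability.
Qed.

Lemma runs_term_eq : runs (fun q : data * data =>
  let a := (read_tree q.1).1 in let b := (read_tree q.2).1 in
  (a.2 == b.2) && (accepts a.1 b.1 && accepts b.1 a.1)).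
Proof.
have h1 : computable (fun q : data * data => (read_tree q.1).1).
  by computability; apply: (c_comp c_read_tree); computability.
have h2 : computable (fun q : data * data => (read_tree q.2).1).
  by computability; apply: (c_comp c_read_tree); computability.
apply: (runs_comp (g := fun q : bool * bool => q.1 && q.2) (f := fun q : data * data =>
  ((read_tree q.1).1.2 == (read_tree q.2).1.2,
   accepts (read_tree q.1).1.1 (read_tree q.2).1.1 &&
   accepts (read_tree q.2).1.1 (read_tree q.1).1.1))).
  by apply: computable_runs; computability.
apply: runs_pair; first by apply: computable_runs; computability.
apply: (runs_comp (f := fun q : data * data =>
  ((read_tree q.1).1.1, (read_tree q.2).1.1)) runs_accepts2).
by apply: computable_runs; computability.
Qed.

(** * Schuetzenberger graphs: computability and finiteness *)

Lemma sch_graphs_computable_I (X : Type) : inhabited X ->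
  sch_graphs_computable (@gen_I X).
Proof.
move=> hX; have [p hp] := runs_sch_graph; exists p => w c hs.
have [d hd] := separates_unname hX hs.
have hw := all_named_letters hd.
exists (sch_finite_graph (cname c) d w); last exact: sch_finite_graph_iso.
rewrite -enc_name_word; have := hp (name_word (cname c) w).
(* The program works with names; on the labels of this graph naming undoes unnaming, so its output
   is the required code. *)
have -> // : enc (sch_graph (name_word (cname c) w)) =
  enc_graph c (sch_finite_graph (cname c) d w).
rewrite /enc_graph; congr (Node _ _); rewrite [RHS]enc_seq_map.
have : forall i b a j, (i, ((b, a), j)) \in (sch_graph (name_word (cname c) w)).2 ->
  name (cname c) (unname d a) = a by move=> i b a j; apply: sch_graph_names.
elim: (sch_graph _).2 => //= -[i [[b a] j]] r ih h /=.
rewrite -ih; last by move=> i' b' a' j' h'; apply: (h i' b' a' j'); rewrite inE h' orbT.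
congr (Node (Node _ (Node _ _)) _).
by rewrite /enc_letter -enc_name /= (h i b a j) ?mem_head.
Qed.

(** Positions in s name its letters. Finiteness then follows from computability under one such
    naming. *)
Lemma separates_ex (X : Type) (s : seq X) : exists c, separates c s.
Proof.
exists (fun x => index (x : {classic X}) (s : seq {classic X})).
move=> x y /set_mem hx /set_mem hy e.
have mem z : List.In z s -> (z : {classic X}) \in (s : seq {classic X}).
  by move/(@In_mem {classic X}).
have := nth_index (x : {classic X}) (mem _ hx).
by rewrite [X in nth _ _ X]e (nth_index _ (mem _ hy)).
Qed.

Lemma finite_set_In (T : Type) (s : seq T) : finite_set [set x | List.In x s].
Proof.
elim: s => [|x s ih] /=; first exact: finite_set0.
rewrite (_ : [set _ | _] = [set x] `|` [set y | List.In y s])%classic.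
  by rewrite finite_setU; split=> //; apply: finite_set1.
by apply/seteqP; split=> y /= [->|]; [left|right|left|right].
Qed.

Lemma graph_iso_finite (L T : Type) (G : finite_graph L) (V : set T)
    (E : set (T * L * T)) :
  (forall e, E e -> V e.1.1 /\ V e.2) -> graph_iso G V E ->
  finite_set V /\ finite_set E.
Proof.
move=> hE [f [fV _ fS] fE]; split.
  apply: (sub_finite_set fS); apply: finite_image; exact: finite_II.
have : finite_set ((fun e : nat * L * nat => (f e.1.1, e.1.2, f e.2)) @`
    [set e | List.In e (edge_list G)])%classic.
  by apply: finite_image; apply: finite_set_In.
apply: sub_finite_set => -[[t l] t'] h.
have [/= /fS [i hi ei] /fS [j hj ej]] := hE _ h.
by exists (i, l, j); [apply/fE; rewrite ei ej | rewrite /= ei ej].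
Qed.

Lemma finite_sch (X : Type) (s : monoid_I X) : inhabited X ->
  finite_set (sch_vertices s) /\ finite_set (sch_edges (@gen_I X) s).
Proof.
move=> hX; elim/inv_class_ind: s => w; rewrite -inv_word_val.
have [c hc] := separates_ex (word_letters w).
have [p /(_ w c hc) [G _ iso]] := sch_graphs_computable_I hX.
by apply: graph_iso_finite iso => -[[t l] t'] [].
Qed.

Theorem theorem8p1 (X : Type) (hX : inhabited X) :
  (forall s : monoid_I X,
     finite_set (sch_vertices s) /\ finite_set (sch_edges (@gen_I X) s)) /\
  sch_graphs_computable (@gen_I X) /\
  decidable_rel (@word_letters X) (@enc_word X)
    (fun u v => word_val (@gen_I X) u = word_val (@gen_I X) v) /\
  decidable_rel (@term_letters X) (@enc_term X)
    (fun s t => term_val (@ffbr_gen X) s = term_val (@ffbr_gen X) t).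
Proof.
split; first by move=> s; apply: finite_sch.
split; first exact: sch_graphs_computable_I.
split.
  have [p hp] := runs_accepts2; exists p => u v c hs.
  have [d hd] := separates_unname hX hs.
  have hu : all_named (cname c) d u.
    by apply: all_named_letters => x hx; apply: hd; apply/List.in_app_iff; left.
  have hv : all_named (cname c) d v.
    by apply: all_named_letters => x hx; apply: hd; apply/List.in_app_iff; right.
  eexists; last exact: (accepts_eq hu hv).
  by rewrite -!enc_name_word; apply: (hp (_, _)).
have [p hp] := runs_term_eq; exists p => s t c hs.
have [d hd] := separates_unname hX hs.
have named r : (forall x, List.In x (term_letters r) -> d (cname c x) = x) ->
    all_named (cname c) d (term_word r).
  by move=> h; apply: all_named_letters => x hx; apply: h; apply: term_word_letters.
have ds x : List.In x (term_letters s) -> d (cname c x) = x.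
  by move=> hx; apply: hd; apply/List.in_app_iff; left.
have dt x : List.In x (term_letters t) -> d (cname c x) = x.
  by move=> hx; apply: hd; apply/List.in_app_iff; right.
eexists; first exact: (hp (enc_term c s, enc_term c t)).
rewrite !read_tree_term /= ffbr_term_eq -(accepts_eq (named s ds) (named t dt)).
(* The program compares named traces; undoing the names recovers the equality of the traces
   themselves. *)
have traceK r : (forall x, List.In x (term_letters r) -> d (cname c x) = x) ->
    map d (map (cname c) (term_trace r)) = term_trace r.
  move=> h; have {}h x : List.In x (term_trace r) -> d (cname c x) = x.
    by move=> hx; apply: h; apply: term_trace_letters.
  elim: (term_trace r) h => //= x u ih h.
  by rewrite h ?ih //; [move=> y hy; apply: h; right | left].
split=> [/andP[/eqP e h]|[-> h]]; last by rewrite eqxx.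
by split=> //; rewrite -(traceK s ds) e traceK.
Qed.
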